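(* Let $p=p_n\to\infty$ with $p/n\to\gamma\in(0,\infty)$ as $n\to\infty$, and let $\mathbf{R}_n$ be the $p\times p$ sample correlation matrix built from i.i.d. copies of a symmetric random variable $\xi$. If $\xi$ is slowly varying (i.e. satisfies the regular variation condition with index $\alpha=0$), then the empirical spectral distribution $F^{\mathbf{R}_n}$ converges weakly in probability to the zero-inflated Poisson distribution $H_{0,\gamma}$ given by $$H_{0,\gamma}(\{0\})=1-\gamma^{-1}+\gamma^{-1}e^{-\gamma},\qquad H_{0,\gamma}(\{k\})=\gamma^{-1}e^{-\gamma}\frac{\gamma^k}{k!},\quad k\in\{1,2,\dots\}.$$
   Context: $\xi$ is symmetric if $\xi$ and $-\xi$ have the same law. $\xi$ is slowly varying if $\mathbb{P}(|\xi|>x)=L(x)$ for $x>0$, where $L:(0,\infty)\to(0,\infty)$ satisfies $L(tx)/L(x)\to1$ as $x\to\infty$ for every $t>0$. For i.i.d. copies $X_{ij}$ ($i,j\ge1$) of $\xi$, let $Y_{ij}=X_{ij}/\sqrt{X_{i1}^2+\cdots+X_{in}^2}$, $\mathbf{Y}_n=(Y_{ij})_{1\le i\le p,1\le j\le n}$ and $\mathbf{R}_n=\mathbf{Y}_n\mathbf{Y}_n^\top$. For a symmetric $p\times p$ matrix $\mathbf{R}$ with eigenvalues $\lambda_1(\mathbf R),\dots,\lambda_p(\mathbf R)$, $F^{\mathbf{R}}=\frac1p\sum_{i=1}^p\delta_{\lambda_i(\mathbf{R})}$. *)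

(* Defs.v *)
From HB Require Import structures.
From mathcomp Require Import all_boot all_order all_algebra finmap.
From mathcomp Require Import polyrcf complex spectral.
From mathcomp Require Import all_classical all_reals all_analysis.

Set Implicit Arguments.
Unset Strict Implicit.
Unset Printing Implicit Defensive.

Import Order.TTheory GRing.Theory Num.Theory.
Import numFieldNormedType.Exports.

Local Open Scope classical_set_scope.
Local Open Scope ring_scope.

Definition same_law (R : realType)
    (d1 : measure_display) (T1 : measurableType d1) (P1 : probability T1 R)
    (X : T1 -> R)
    (d2 : measure_display) (T2 : measurableType d2) (P2 : probability T2 R)
    (Y : T2 -> R) : Prop :=
  forall B : set R, measurable B -> P1 (X @^-1` B) = P2 (Y @^-1` B).

Definition mutually_independent (R : realType)
    (d : measure_display) (T : measurableType d) (P : probability T R)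
    (I : choiceType) (X : I -> {RV P >-> R}) : Prop :=
  forall (J : {fset I}) (B : I -> set R), (forall i, measurable (B i)) ->
    P (\bigcap_(i in [set` J]) X i @^-1` B i) =
    (\prod_(i <- J) P (X i @^-1` B i))%E.

Definition iid_copies (R : realType)
    (d : measure_display) (T : measurableType d) (P : probability T R)
    (d' : measure_display) (T' : measurableType d') (Q : probability T' R)
    (I : choiceType) (X : I -> {RV P >-> R}) (xi : {RV Q >-> R}) : Prop :=
  mutually_independent X /\ (forall i, same_law P (X i) Q xi).

Definition symmetric_rv (R : realType)
    (d : measure_display) (T : measurableType d) (P : probability T R)
    (xi : {RV P >-> R}) : Prop :=
  same_law P xi P (\- xi).

Definition slowly_varying_rv (R : realType)
    (d : measure_display) (T : measurableType d) (P : probability T R)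
    (xi : {RV P >-> R}) : Prop :=
  exists L : R -> R,
    [/\ forall x, 0 < x -> 0 < L x,
        forall x, 0 < x -> P [set w | x < `|xi w|] = (L x)%:E &
        forall t, 0 < t -> L (t * x) / L x @[x --> +oo] --> (1 : R)].

(* Row and column indices start at 0. A row with zero norm is sent to the zero
   row, by the convention [x / 0 = 0]. *)
Definition normalized_data (R : realType) (T : Type) (X : nat -> nat -> T -> R)
    (p n : nat) (w : T) : 'M[R]_(p, n) :=
  \matrix_(i < p, j < n) (X i j w / Num.sqrt (\sum_(k < n) X i k w ^+ 2)).

Definition sample_correlation (R : realType) (T : Type)
    (X : nat -> nat -> T -> R) (p n : nat) (w : T) : 'M[R]_p :=
  normalized_data X p n w *m (normalized_data X p n w)^T.

(* The real eigenvalues in nondecreasing order, repeated according to their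
   algebraic multiplicity. *)
Definition eigenvalues (R : realType) (p : nat) (A : 'M[R]_p) : seq R :=
  flatten [seq nseq (mup x (char_poly A)) x | x <- rootsR (char_poly A)].

(* For a symmetric matrix, the real eigenvalues exhaust the spectrum. *)
Lemma char_poly_eigenvalues (R : realType) (p : nat) (A : 'M[R]_p) :
  A^T = A -> char_poly A = \prod_(x <- eigenvalues A) ('X - x%:P).
Proof.
move=> As.
have cA0 : char_poly A != 0 by rewrite monic_neq0 ?char_poly_monic.
pose AC := map_mx (real_complex R) A.
have ACh : AC \is hermsymmx.
  apply: realsym_hermsym.
    by apply/is_hermitianmxP; rewrite expr0 scale1r map_mx_id// map_trmx As.
  by apply/mxOverP => i j; rewrite mxE complex_real.
pose d := spectral_diag AC.
have dR j : (complex.Re (d 0 j : R[i]))%:C%C = d 0 j.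
  by apply: RRe_real; have /mxOverP := hermitian_spectral_diag_real ACh; exact.
have ACE : char_poly AC = \prod_j ('X - (d 0 j)%:P).
  have /hermitian_normalmx/orthomx_spectralP := ACh.
  have := spectral_unit AC; rewrite -/d; set P := spectralmx AC => Pu ACd.
  pose PX := map_mx polyC P; pose PV := map_mx polyC (invmx P).
  have PVP : PV *m PX = 1%:M by rewrite -map_mxM mulVmx// map_mx1.
  have -> : \prod_j ('X - (d 0 j)%:P) = char_poly (diag_mx d).
    rewrite char_poly_trig ?diag_mx_is_trig//.
    by apply: eq_bigr => j _; rewrite [diag_mx _ _ _]mxE eqxx mulr1n.
  rewrite /char_poly.
  have -> : char_poly_mx AC = PV *m char_poly_mx (diag_mx d) *m PX.
    rewrite /char_poly_mx mulmxBr mulmxBl {1}ACd !map_mxM; congr (_ - _).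
    by rewrite scalar_mxC -mulmxA PVP mulmx1.
  by rewrite !det_mulmx mulrAC -det_mulmx PVP det1 mul1r.
pose r := [seq complex.Re (d 0 j : R[i]) | j <- enum 'I_p].
have pE : char_poly A = \prod_(x <- r) ('X - x%:P).
  apply: (map_poly_inj (real_complex R)).
  rewrite map_char_poly -/AC ACE rmorph_prod /r big_map big_enum/=.
  by apply: eq_bigr => j _; rewrite map_polyXsubC/= dR.
rewrite [LHS]pE; apply: perm_big; rewrite perm_sym.
apply/allP => /= x _; apply/eqP.
rewrite -[RHS]mu_prod_XsubC -pE /eigenvalues count_flatten -map_comp.
under eq_map do rewrite /= count_nseq.
rewrite sumnE big_map.
have [rx|nrx] := boolP (x \in rootsR (char_poly A)); last first.
  rewrite big1_seq => [|y /andP[_ yr]].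
    by rewrite mupNroot//; move: nrx; rewrite -roots_on_rootsR.
  have yx : y != x by apply: contraNneq nrx => <-.
  by rewrite /= (negPf yx).
rewrite (bigD1_seq x)//= ?uniq_roots// eqxx mul1n big1 ?addn0// => y.
by move=> /negPf ->.
Qed.

(* [p = 0] gives the zero measure. *)
Definition esd (R : realType) (p : nat) (A : 'M[R]_p) :
    {measure set R -> \bar R} :=
  mscale (p%:R^-1)%:nng
    (msum (fun i => \d_((eigenvalues A)`_i)) (size (eigenvalues A))).

Definition zip_pmf (R : realType) (gamma : R) (k : nat) : R :=
  if k == 0 then 1 - gamma^-1 + gamma^-1 * expR (- gamma)
  else gamma^-1 * expR (- gamma) * (gamma ^+ k / k`!%:R).

Lemma zip_pmf_ge0 (R : realType) (gamma : {posnum R}) (k : nat) :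
  0 <= zip_pmf gamma%:num k.
Proof.
rewrite /zip_pmf; case: eqP => _; last first.
  by rewrite !mulr_ge0// ?invr_ge0// ?expR_ge0// exprn_ge0.
have g0 : 0 < gamma%:num by [].
rewrite -(pmulr_rge0 _ g0) mulrDr mulrBr mulVKf ?gt_eqF// mulfV ?gt_eqF// mulr1.
by rewrite addrAC subr_ge0 addrC -lerBlDr expR_ge1Dx.
Qed.

Definition zip_measure (R : realType) (gamma : {posnum R}) :
    {measure set R -> \bar R} :=
  mseries (fun k => mscale (NngNum (zip_pmf_ge0 gamma k)) \d_(k%:R : R)) 0.

Lemma zip_measureE (R : realType) (gamma : {posnum R}) (A : set R) :
  zip_measure gamma A =
  (\sum_(0 <= k <oo) (zip_pmf gamma%:num k)%:E * \d_(k%:R : R) A)%E.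
Proof. by []. Qed.

Lemma zip_measure1 (R : realType) (gamma : {posnum R}) (k : nat) :
  zip_measure gamma [set k%:R] = (zip_pmf gamma%:num k)%:E.
Proof.
rewrite zip_measureE (@nneseriesD1 _ _ k)//; last first.
  by move=> i _; rewrite mule_ge0// lee_fin zip_pmf_ge0.
rewrite eseries0 => [|i _ /andP[_ ik]].
  by rewrite adde0 diracE mem_set// mule1.
by rewrite diracE memNset ?mule0//= => /eqP; rewrite eqr_nat (negPf ik).
Qed.

Lemma zip_measureT (R : realType) (gamma : {posnum R}) :
  zip_measure gamma setT = 1%E.
Proof.
have g0 : 0 < gamma%:num by [].
rewrite zip_measureE.
under eq_eseriesr do rewrite diracT mule1.
apply/cvg_lim => //; rewrite -(cvg_shiftS _).
under eq_fun do rewrite sumEFin.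
apply/fine_cvgP; split; first exact: nearW.
set e := expR (- gamma%:num).
have E n : \sum_(0 <= k < n.+1) zip_pmf gamma%:num k =
    1 - gamma%:num^-1 + gamma%:num^-1 * e * series (exp_coeff gamma%:num) n.+1.
  rewrite /series/= !big_nat_recl//= /exp_coeff/= expr0 fact0 invr1 mulr1 mulrDr mulr1.
  rewrite addrA; congr (_ + _); rewrite mulr_sumr.
  by apply: eq_bigr => i _.
rewrite (_ : _ \o _ = fun n => 1 - gamma%:num^-1 +
    gamma%:num^-1 * e * series (exp_coeff gamma%:num) n.+1); last first.
  by apply/funext => n /=; rewrite E.
rewrite [X in _ --> X](_ : _ = 1 - gamma%:num^-1 +
    gamma%:num^-1 * e * expR gamma%:num); last first.
  by rewrite -mulrA /e expRN mulVf ?gt_eqF ?expR_gt0// mulr1 subrK.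
apply: cvgD; first exact: cvg_cst.
apply: cvgMl_tmp; rewrite (cvg_shiftS (series _)).
exact: is_cvg_series_exp_coeff.
Qed.

Definition cvg_weakly_in_probability (R : realType)
    (d : measure_display) (T : measurableType d) (P : probability T R)
    (mu : nat -> T -> {measure set R -> \bar R})
    (nu : {measure set R -> \bar R}) : Prop :=
  forall f : R -> R, continuous f -> bounded_fun f ->
  forall eps : R, 0 < eps ->
    P [set w | eps < `|\int[mu n w]_x f x - \int[nu]_x f x|]
      @[n --> \oo] --> 0%E.

(* Main.v *)
Require Import Defs.
From HB Require Import structures.
From mathcomp Require Import all_boot all_order all_algebra perm finmap.
From mathcomp Require Import polyrcf complex spectral.
From mathcomp Require Import all_classical all_reals all_analysis.
From mathcomp Require Import measurable_realfun.
From mathcomp Require Import ring lra.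

(* A slowly varying entry makes the largest square of a row dominate the sum of
   all its squares, so the normalized row is close to a signed basis vector
   pointing to a uniformly chosen column.  Replacing the rows by these vectors
   turns Y^T Y into the diagonal matrix of the bin counts of p balls thrown in n
   bins, whose empirical distribution is asymptotically Poisson(gamma); the
   zeros of H account for the p - n missing (or superfluous) null eigenvalues.

   To make this quantitative, the entries are replaced by their dyadic levels,
   which take finitely many values and whose joint law is an explicit product
   weight.  Domination is decided on the levels, and the indicators of
   domination of column j by row i form p independent rows with success
   probability q, where n q -> 1: this follows from the Karamata estimate on
   the truncated second moment and a telescoping sum over the levels.  Hence
   z^(bin count), averaged over the bins, converges in L^2 to
   exp(- gamma (1 - z)).  Spectra are compared through the symmetric dilation
   of Y and a doubly stochastic coupling of eigenvalues, which only costs a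
   Frobenius norm.  Finally the functions exp(- k x) determine the limit, by
   the Weierstrass theorem in the variable exp(- x) and the bound on the mean
   of the spectral distribution. *)

Set Implicit Arguments.
Unset Strict Implicit.
Unset Printing Implicit Defensive.

Import Order.TTheory GRing.Theory Num.Theory.
Import numFieldNormedType.Exports.

Local Open Scope classical_set_scope.
Local Open Scope ring_scope.

(** * Spectral comparison *)

(** In the continuum, the probability that some column dominates is, up to a small error, the
    integral of n (1 - G)^(n-1) dG = 1, with G the tail. Rounding to levels replaces this integral
    by a finite telescoping sum, and all expectations by sums over a finite product space. Only the
    lower bound n q >= 1 - e needs slow variation: two columns cannot dominate the same row, so n q
    <= 1 always holds. The same exclusivity makes the joint moment of two bin counts explicit, which
    is why a second-moment argument suffices. The ratio N of domination is fixed before n tends to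
    infinity. It leaves a Frobenius error of at most 2/N per dominated row and 1 per undominated
    row, and the latter rows are a vanishing fraction. The cap M on the levels depends on n and is
    only required to be high enough that n^2 P(level >= M) <= 1. *)

Lemma perm_eq_prod_XsubC (F : fieldType) (r s : seq F) :
  \prod_(x <- r) ('X - x%:P) = \prod_(x <- s) ('X - x%:P) -> perm_eq r s.
Proof.
move=> rs; apply/allP => /= x _; apply/eqP.
by rewrite -[LHS]mu_prod_XsubC rs mu_prod_XsubC.
Qed.

Lemma sum_eigenvalues (R : realType) (m : nat) (A : 'M[R]_m) (s : seq R)
    (g : R -> R) :
  A^T = A -> char_poly A = \prod_(x <- s) ('X - x%:P) ->
  \sum_(x <- eigenvalues A) g x = \sum_(x <- s) g x.
Proof.
move=> /char_poly_eigenvalues -> /perm_eq_prod_XsubC; exact: perm_big.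
Qed.

Lemma sum_eigenvalues_fin (R : realType) (m : nat) (A : 'M[R]_m)
    (I : finType) (a : I -> R) (g : R -> R) :
  A^T = A -> char_poly A = \prod_j ('X - (a j)%:P) ->
  \sum_(x <- eigenvalues A) g x = \sum_j g (a j).
Proof.
move=> As cA; rewrite (@sum_eigenvalues _ _ _ [seq a j | j <- enum I])//.
  by rewrite big_map big_enum.
by rewrite big_map big_enum.
Qed.

Lemma size_eigenvalues (R : realType) (m : nat) (A : 'M[R]_m) :
  A^T = A -> size (eigenvalues A) = m.
Proof.
move=> /char_poly_eigenvalues cA; apply: succn_inj.
by rewrite -(size_char_poly A) cA size_prod_XsubC.
Qed.

(** The diagonalization takes place over [R[i]], where the unitary matrix lives. The spectral
    diagonal of a hermitian matrix is real, so the eigenvalues themselves can be given in [R]. *)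
Lemma symmetric_spectral (R : realType) (m : nat) (A : 'M[R]_m) :
  A^T = A -> exists (a : 'rV[R]_m) (U : 'M[R[i]]_m),
  [/\ U \is unitarymx,
      map_mx (real_complex R) A =
        invmx U *m diag_mx (map_mx (real_complex R) a) *m U &
      char_poly A = \prod_j ('X - (a 0 j)%:P)].
Proof.
move=> As.
pose AC := map_mx (real_complex R) A.
have ACh : AC \is hermsymmx.
  apply: realsym_hermsym.
    by apply/is_hermitianmxP; rewrite expr0 scale1r map_mx_id// map_trmx As.
  by apply/mxOverP => i j; rewrite mxE complex_real.
pose d := spectral_diag AC.
pose a : 'rV[R]_m := \row_j complex.Re (d 0 j : R[i]).
have adE : map_mx (real_complex R) a = d.
  apply/rowP => j; rewrite !mxE.
  by apply: RRe_real; have /mxOverP := hermitian_spectral_diag_real ACh; exact.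
exists a, (spectralmx AC).
have /hermitian_normalmx/orthomx_spectralP := ACh.
rewrite -/d -adE => ACE; split => //; first exact: spectral_unitarymx.
have Uu := spectral_unit AC; set U := spectralmx AC in ACE Uu.
apply: (map_poly_inj (real_complex R)).
rewrite map_char_poly -/AC rmorph_prod/=.
under eq_bigr do rewrite map_polyXsubC/=.
have -> : \prod_j ('X - ((a 0 j)%:C%C)%:P) =
    char_poly (diag_mx (map_mx (real_complex R) a)).
  rewrite char_poly_trig ?diag_mx_is_trig//.
  by apply: eq_bigr => j _; rewrite [diag_mx _ _ _]mxE eqxx mulr1n [X in _ = _ - X%:P]mxE.
pose PX := map_mx polyC U; pose PV := map_mx polyC (invmx U).
have PVP : PV *m PX = 1%:M by rewrite -map_mxM mulVmx// map_mx1.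
rewrite /char_poly; set D := diag_mx _ in ACE *.
have -> : char_poly_mx AC = PV *m char_poly_mx D *m PX.
  rewrite /char_poly_mx mulmxBr mulmxBl {1}ACE !map_mxM; congr (_ - _).
  by rewrite scalar_mxC -mulmxA PVP mulmx1.
by rewrite !det_mulmx mulrAC -det_mulmx PVP det1 mul1r.
Qed.

Lemma map_mx_exp (K L : pzRingType) (f : {rmorphism K -> L}) (m : nat)
    (A : 'M[K]_m) (k : nat) :
  map_mx f (A ^+ k) = map_mx f A ^+ k.
Proof.
elim: k => [|k IH]; first by rewrite !expr0 map_mx1.
by rewrite !exprS -IH; exact: map_mxM.
Qed.

Lemma mxtrace_conj_diag_exp (C : comUnitRingType) (m : nat) (U : 'M[C]_m)
    (a : 'rV[C]_m) (k : nat) :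
  U \in unitmx ->
  \tr ((invmx U *m diag_mx a *m U) ^+ k) = \sum_j (a 0 j) ^+ k.
Proof.
move=> Uu; set A := _ *m U.
have -> : A ^+ k = invmx U *m diag_mx (\row_j ((a 0 j) ^+ k)) *m U.
  elim: k => [|k IH].
    rewrite expr0 (_ : diag_mx _ = 1%:M); last first.
      by apply/matrixP => i j; rewrite !mxE expr0.
    by rewrite mulmx1 mulVmx.
  have -> : A ^+ k.+1 = A *m A ^+ k by exact: exprS.
  rewrite IH /A !mulmxA (mulmxK Uu) -[X in X *m U = _]mulmxA mulmx_diag.
  congr (_ *m diag_mx _ *m _).
  by apply/rowP => j; rewrite !mxE exprS.
rewrite mxtrace_mulC mulmxA mulmxV// mul1mx mxtrace_diag.
by apply: eq_bigr => j _; rewrite mxE.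
Qed.

(** Links spectral sums to polynomials in the entries. It serves both the Frobenius identity for
    squares and the measurability of spectral sums. *)
Lemma mxtrace_exp_eigenvalues (R : realType) (m : nat) (A : 'M[R]_m) (k : nat) :
  A^T = A -> \tr (A ^+ k) = \sum_(x <- eigenvalues A) x ^+ k.
Proof.
move=> As; have [a [U [Uu AE cA]]] := symmetric_spectral As.
rewrite (sum_eigenvalues_fin _ As cA).
apply: (@complexI R); rewrite [RHS]rmorph_sum/=.
transitivity (\tr (map_mx (real_complex R) (A ^+ k))).
  by rewrite trace_map_mx.
rewrite map_mx_exp AE mxtrace_conj_diag_exp ?unitarymx_unit//.
by apply: eq_bigr => j _; rewrite mxE rmorphXn.
Qed.

(** By cyclicity the trace is that of diag(a) W diag(b) W^(-1), and the entries of W^(-1) are the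
    conjugates of those of W. Rows and columns of a unitary matrix have norm 1, so the squared
    moduli form a doubly stochastic matrix. *)
Lemma unitary_coupling (C : numClosedFieldType) (m : nat) (U V : 'M[C]_m) :
  U \is unitarymx -> V \is unitarymx ->
  let W := U *m invmx V in
  [/\ forall i, \sum_j `|W i j| ^+ 2 = 1, forall j, \sum_i `|W i j| ^+ 2 = 1 &
      forall a b : 'rV[C]_m,
      \tr ((invmx U *m diag_mx a *m U) *m (invmx V *m diag_mx b *m V)) =
      \sum_i \sum_j `|W i j| ^+ 2 * (a 0 i * b 0 j)].
Proof.
move=> Uu Vu W.
have Wu : W \is unitarymx.
  by rewrite /W invmx_unitary// mul_unitarymx// trmxC_unitary.
have Wi : W \in unitmx by exact: unitarymx_unit.
have WE i j : `|W i j| ^+ 2 = W i j * invmx W j i.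
  by rewrite normCK invmx_unitary// !mxE.
have WVE : invmx W = V *m invmx U.
  by rewrite invmx_unitary// /W trmx_mul map_mxM/= !invmx_unitary// trmxCK.
split.
- move=> i; transitivity ((W *m invmx W) i i); last by rewrite mulmxV// mxE eqxx.
  by rewrite [RHS]mxE; apply: eq_bigr => j _; rewrite WE.
- move=> i; transitivity ((invmx W *m W) i i); last by rewrite mulVmx// mxE eqxx.
  by rewrite [RHS]mxE; apply: eq_bigr => j _; rewrite WE mulrC.
- move=> a b.
  rewrite -!mulmxA mxtrace_mulC -!mulmxA -WVE.
  rewrite (mulmxA U) -/W /mxtrace; clearbody W; apply: eq_bigr => i _.
  rewrite mul_diag_mx !mxE mulr_sumr.
  apply: eq_bigr => j _; rewrite mul_diag_mx !mxE WE; ring.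
Qed.

(* Writing U, V for the unitary diagonalizers, S i j is the squared modulus of
   the (i, j) entry of U V^*. *)
Lemma spectral_coupling (R : realType) (m : nat) (A B : 'M[R]_m) :
  A^T = A -> B^T = B -> exists (a b : 'I_m -> R) (S : 'I_m -> 'I_m -> R),
  [/\ char_poly A = \prod_j ('X - (a j)%:P),
      char_poly B = \prod_j ('X - (b j)%:P),
      forall i j, 0 <= S i j,
      (forall i, \sum_j S i j = 1) /\ (forall j, \sum_i S i j = 1) &
      \tr (A *m B) = \sum_i \sum_j S i j * (a i * b j)].
Proof.
move=> As Bs.
have [a [U [Uu AE cA]]] := symmetric_spectral As.
have [b [V [Vu BE cB]]] := symmetric_spectral Bs.
have := unitary_coupling Uu Vu; set W := U *m invmx V => -[W1 W2 WT].
pose S i j : R := complex.Re (W i j) ^+ 2 + complex.Im (W i j) ^+ 2.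
have SE i j : (S i j)%:C%C = `|W i j| ^+ 2.
  rewrite /S; case: (W i j) => x y /=.
  by rewrite normc_def/= -rmorphXn/= sqr_sqrtr// addr_ge0// sqr_ge0.
exists (fun j => a 0 j), (fun j => b 0 j), S; split => //.
- by move=> i j; rewrite addr_ge0// sqr_ge0.
- split=> i; apply: (@complexI R); rewrite rmorph_sum/=.
  + by rewrite -[RHS](W1 i); apply: eq_bigr => j _; rewrite SE.
  + by rewrite -[RHS](W2 i); apply: eq_bigr => j _; rewrite SE.
- apply: (@complexI R); rewrite [RHS]rmorph_sum/=.
  transitivity (\tr (map_mx (real_complex R) (A *m B))); first by rewrite trace_map_mx.
  rewrite map_mxM AE BE WT; apply: eq_bigr => i _.
  rewrite rmorph_sum/=; apply: eq_bigr => j _.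
  by rewrite !rmorphM/= SE !mxE.
Qed.

(** Replaces Cauchy-Schwarz by a bound linear in x^2, which can be summed against a coupling;
    [theta] is tuned at the end. *)
Lemma mulr_normr_le_theta (R : realFieldType) (L theta x : R) :
  0 <= L -> 0 < theta -> L * `|x| <= L * (theta + x ^+ 2 / theta).
Proof.
move=> L0 t0; apply: ler_wpM2l => //.
rewrite -(ler_pM2r t0) mulrDl mulfVK ?gt_eqF// -real_normK ?num_real//.
by have := normr_ge0 x; nra.
Qed.

(** Both spectral sums are marginals of the coupling S, so their difference is the S-sum of g(a_i) -
    g(b_j), and the S-sum of (a_i - b_j)^2 is exactly the squared Frobenius norm of A - B. *)
Lemma eigenvalues_lipschitz (R : realType) (m : nat) (A B : 'M[R]_m)
    (g : R -> R) (L theta : R) :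
  A^T = A -> B^T = B -> 0 <= L -> 0 < theta ->
  (forall x y, `|g x - g y| <= L * `|x - y|) ->
  `|\sum_(x <- eigenvalues A) g x - \sum_(x <- eigenvalues B) g x| <=
    L * (theta * m%:R + \tr ((A - B) *m (A - B)) / theta).
Proof.
move=> As Bs L0 t0 gL.
have [a [b [S [cA cB S0 [S1 S2] trAB]]]] := spectral_coupling As Bs.
have tr2 C (Cs : C^T = C) (c : 'I_m -> R)
    (cC : char_poly C = \prod_j ('X - (c j)%:P)) :
    \tr (C *m C) = \sum_j c j ^+ 2.
  have -> : C *m C = C ^+ 2 by rewrite expr2.
  by rewrite mxtrace_exp_eigenvalues// (sum_eigenvalues_fin _ _ cC).
rewrite (sum_eigenvalues_fin g As cA) (sum_eigenvalues_fin g Bs cB).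
(* Hoffman-Wielandt identity: the squares come from the marginals of S and the cross term from the
   trace of A B. *)
have -> : \tr ((A - B) *m (A - B)) = \sum_i \sum_j S i j * (a i - b j) ^+ 2.
  have -> : (A - B) *m (A - B) = A *m A - A *m B - (B *m A - B *m B).
    by rewrite mulmxBl !mulmxBr.
  rewrite !raddfB/= [\tr (B *m A)]mxtrace_mulC.
  rewrite (tr2 _ _ As _ cA) (tr2 _ _ Bs _ cB) trAB.
  have -> : \sum_j a j ^+ 2 = \sum_i \sum_j S i j * a i ^+ 2.
    by apply: eq_bigr => i _; rewrite -mulr_suml S1 mul1r.
  have -> : \sum_j b j ^+ 2 = \sum_i \sum_j S i j * b j ^+ 2.
    by rewrite exchange_big; apply: eq_bigr => i _; rewrite -mulr_suml S2 mul1r.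
  rewrite opprK [X in _ + X]addrC -!sumrB -big_split; apply: eq_bigr => i _.
  rewrite -!sumrB -big_split; apply: eq_bigr => j _ /=.
  ring.
have -> : \sum_j g (a j) - \sum_j g (b j) = \sum_i \sum_j S i j * (g (a i) - g (b j)).
  transitivity (\sum_i \sum_j S i j * g (a i) - \sum_i \sum_j S i j * g (b j)).
    congr (_ - _).
      by apply: eq_bigr => i _; rewrite -mulr_suml S1 mul1r.
    by rewrite exchange_big; apply: eq_bigr => i _; rewrite -mulr_suml S2 mul1r.
  rewrite -sumrB; apply: eq_bigr => i _; rewrite -sumrB; apply: eq_bigr => j _.
  by rewrite mulrBr.
have -> : L * (theta * m%:R + (\sum_i \sum_j S i j * (a i - b j) ^+ 2) / theta) =
    \sum_i \sum_j S i j * (L * (theta + (a i - b j) ^+ 2 / theta)).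
  have -> : theta * m%:R = \sum_i \sum_j S i j * theta.
    rewrite -[m in LHS]card_ord -sum1_card natr_sum mulr_sumr.
    by apply: eq_bigr => i _; rewrite -mulr_suml S1 mul1r mulr1.
  rewrite mulr_suml -big_split mulr_sumr/=; apply: eq_bigr => i _.
  rewrite mulr_suml -big_split mulr_sumr/=; apply: eq_bigr => j _.
  ring.
apply: le_trans (ler_norm_sum _ _ _) _; apply: ler_sum => i _.
apply: le_trans (ler_norm_sum _ _ _) _; apply: ler_sum => j _.
rewrite normrM ger0_norm ?S0// ler_wpM2l//.
by apply: le_trans (gL _ _) _; exact: mulr_normr_le_theta.
Qed.

Definition dilation (R : nzRingType) (p n : nat) (Y : 'M[R]_(p, n)) :
  'M[R]_(p + n) := block_mx 0 Y Y^T 0.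

Lemma dilation_sym (R : nzRingType) (p n : nat) (Y : 'M[R]_(p, n)) :
  (dilation Y)^T = dilation Y.
Proof. by rewrite /dilation tr_block_mx !trmx0 trmxK. Qed.

Lemma char_poly_compX2 (R : comNzRingType) (m : nat) (A : 'M[R]_m) :
  char_poly A \Po 'X^2 = \det (('X^2)%:M - map_mx polyC A).
Proof.
rewrite /char_poly -(det_map_mx (comp_poly 'X^2)) /char_poly_mx map_mxB/=.
congr (\det (_ - _)); first by rewrite map_scalar_mx/= comp_polyX.
by apply/matrixP => i j; rewrite !mxE/= comp_polyC.
Qed.

(** Schur complement without division: multiplying the characteristic matrix by a block triangular
    matrix of determinant X^p clears one off-diagonal block. *)
Lemma char_poly_dilation (R : idomainType) (p n : nat) (Y : 'M[R]_(p, n)) :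
  char_poly (dilation Y) * 'X^p = (char_poly (Y *m Y^T) \Po 'X^2) * 'X^n.
Proof.
rewrite char_poly_compX2; pose Z := map_mx polyC Y.
have -> : map_mx polyC (Y *m Y^T) = Z *m Z^T by rewrite map_mxM map_trmx.
have HE : char_poly_mx (dilation Y) = block_mx 'X%:M (- Z) (- Z^T) 'X%:M.
  rewrite /char_poly_mx /dilation map_block_mx !map_mx0 -/Z map_trmx -/Z.
  by rewrite scalar_mx_block opp_block_mx add_block_mx !oppr0 !add0r !addr0.
have dP : \det (block_mx 'X%:M 0 Z^T 1%:M) = 'X^p.
  by rewrite det_lblock det_scalar det1 mulr1.
rewrite /char_poly HE -dP -det_mulmx mulmx_block !mulmx0 !mulmx1 !add0r.
have -> : - Z^T *m 'X%:M + 'X%:M *m Z^T = 0.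
  by rewrite mulNmx scalar_mxC addNr.
by rewrite det_ublock det_scalar -scalar_mxM -expr2 mulNmx.
Qed.

Lemma char_poly_dilation_tr (R : idomainType) (p n : nat) (Y : 'M[R]_(p, n)) :
  char_poly (dilation Y) * 'X^n = (char_poly (Y^T *m Y) \Po 'X^2) * 'X^p.
Proof.
rewrite char_poly_compX2; pose Z := map_mx polyC Y.
have -> : map_mx polyC (Y^T *m Y) = Z^T *m Z by rewrite map_mxM map_trmx.
have HE : char_poly_mx (dilation Y) = block_mx 'X%:M (- Z) (- Z^T) 'X%:M.
  rewrite /char_poly_mx /dilation map_block_mx !map_mx0 -/Z map_trmx -/Z.
  by rewrite scalar_mx_block opp_block_mx add_block_mx !oppr0 !add0r !addr0.
have dP : \det (block_mx 1%:M Z 0 'X%:M) = 'X^n.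
  by rewrite det_ublock det1 det_scalar mul1r.
rewrite /char_poly HE -dP -det_mulmx mulmx_block !mulmx0 !mulmx1 !addr0.
have -> : 'X%:M *m Z + - Z *m 'X%:M = 0.
  by rewrite mulNmx scalar_mxC addrN.
by rewrite det_lblock det_scalar -scalar_mxM -expr2 mulNmx addrC mulrC.
Qed.

Lemma eigenvalues_gram_ge0 (R : realType) (p n : nat) (Y : 'M[R]_(p, n)) (x : R) :
  x \in eigenvalues (Y *m Y^T) -> 0 <= x.
Proof.
have As : (Y *m Y^T)^T = Y *m Y^T by rewrite trmx_mul trmxK.
move=> xA; have : eigenvalue (Y *m Y^T) x.
  by rewrite eigenvalue_root_char char_poly_eigenvalues// root_prod_XsubC.
move=> /eigenvalueP[v vE v0].
have sq q (u : 'rV[R]_q) : (u *m u^T) 0 0 = \sum_j u 0 j ^+ 2.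
  by rewrite mxE; apply: eq_bigr => j _; rewrite mxE -expr2.
have : ((v *m Y) *m (v *m Y)^T) 0 0 = x * (v *m v^T) 0 0.
  by rewrite trmx_mul mulmxA -(mulmxA v) vE -scalemxAl mxE.
rewrite !sq => E.
have vp : 0 < \sum_j v 0 j ^+ 2.
  rewrite lt0r sumr_ge0 ?andbT; last by move=> j _; exact: sqr_ge0.
  apply: contra v0 => /eqP /psumr_eq0P v0.
  apply/eqP/rowP => j; rewrite mxE; apply/eqP.
  by rewrite -sqrf_eq0 v0// => i _; exact: sqr_ge0.
rewrite -(pmulr_lge0 _ vp) -E.
by apply: sumr_ge0 => j _; exact: sqr_ge0.
Qed.

(** Each root x of the Gram polynomial gives the two roots sqrt x and - sqrt x of H, hence the
    factor 2. Padding both root lists with zeros avoids deciding which of a and b is larger. *)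
Lemma sum_eigenvalues_gram (R : realType) (m a b : nat) (H : 'M[R]_m)
    (s : seq R) (h : R -> R) :
  H^T = H -> (forall x, x \in s -> 0 <= x) ->
  char_poly H * 'X^a = ((\prod_(x <- s) ('X - x%:P)) \Po 'X^2) * 'X^b ->
  \sum_(x <- eigenvalues H) h (x ^+ 2) + h 0 *+ a =
  (\sum_(x <- s) h x) *+ 2 + h 0 *+ b.
Proof.
move=> Hs s0 cH.
pose t := flatten [seq [:: Num.sqrt x; - Num.sqrt x] | x <- s].
have nseqE k : 'X^k = \prod_(x <- nseq k (0 : R)) ('X - x%:P).
  by rewrite big_nseq -Monoid.iteropE subr0.
have tE : (\prod_(x <- s) ('X - x%:P)) \Po 'X^2 = \prod_(x <- t) ('X - x%:P).
  rewrite rmorph_prod/= /t big_flatten big_map.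
  rewrite big_seq [RHS]big_seq; apply: eq_bigr => x xs.
  rewrite !big_cons big_nil/= mulr1 polyCN opprK comp_polyB comp_polyX comp_polyC.
  rewrite -{1}(sqr_sqrtr (s0 _ xs)) polyC_exp; ring.
have peq : perm_eq (eigenvalues H ++ nseq a 0) (t ++ nseq b 0).
  apply: perm_eq_prod_XsubC.
  by rewrite !big_cat/= -char_poly_eigenvalues// -!nseqE cH tE.
have : \sum_(x <- eigenvalues H ++ nseq a 0) h (x ^+ 2) =
    \sum_(x <- t ++ nseq b 0) h (x ^+ 2) by exact: perm_big.
rewrite !big_cat !big_nseq -!Monoid.iteropE !expr0n/= => {}E.
have e k : iterop k +%R (h 0) 0 = h 0 *+ k by [].
rewrite !e in E; rewrite E; congr (_ + _).
rewrite /t big_flatten big_map -sumrMnl big_seq [RHS]big_seq.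
apply: eq_bigr => x xs.
by rewrite !big_cons big_nil/= addr0 sqrrN !sqr_sqrtr ?s0// mulr2n.
Qed.

(* The dilation turns a Lipschitz function of the singular values into a trace
   function, so that the comparison only involves the Frobenius norm of
   [Y - Z] and no operator norm. *)
Lemma gram_perturbation (R : realType) (p n : nat) (Y Z : 'M[R]_(p, n))
    (N : 'I_n -> R) (h : R -> R) (L theta : R) :
  Z^T *m Z = diag_mx (\row_j N j) -> (forall j, 0 <= N j) ->
  0 <= L -> 0 < theta ->
  (forall x y, `|h (x ^+ 2) - h (y ^+ 2)| <= L * `|x - y|) ->
  `|\sum_(x <- eigenvalues (Y *m Y^T)) h x
    - (\sum_j h (N j) + h 0 * (p%:R - n%:R))| <=
  L * (theta * (p%:R + n%:R) + (\sum_i \sum_j (Y i j - Z i j) ^+ 2) / theta).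
Proof.
move=> ZN N0 L0 t0 hL.
have YYs : (Y *m Y^T)^T = Y *m Y^T by rewrite trmx_mul trmxK.
have := char_poly_dilation Y; rewrite (char_poly_eigenvalues YYs).
move=> /(sum_eigenvalues_gram h (dilation_sym Y) (@eigenvalues_gram_ge0 _ _ _ Y)) EY.
have := char_poly_dilation_tr Z.
have -> : char_poly (Z^T *m Z) = \prod_(x <- [seq N j | j <- enum 'I_n]) ('X - x%:P).
  rewrite ZN char_poly_trig ?diag_mx_is_trig// big_map big_enum.
  by apply: eq_bigr => j _; rewrite [diag_mx _ _ _]mxE eqxx mulr1n mxE.
have N0' x : x \in [seq N j | j <- enum 'I_n] -> 0 <= x.
  by move=> /mapP[j _ ->]; exact: N0.
move=> /(sum_eigenvalues_gram h (dilation_sym Z) N0') EZ.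
rewrite big_map big_enum/= in EZ.
have := eigenvalues_lipschitz (dilation_sym Y) (dilation_sym Z) L0 t0 hL.
(* The two off-diagonal blocks count the Frobenius norm twice; this factor cancels the one due to
   the two signs of each singular value. *)
have -> : \tr ((dilation Y - dilation Z) *m (dilation Y - dilation Z)) =
    2 * \sum_i \sum_j (Y i j - Z i j) ^+ 2.
  have -> : dilation Y - dilation Z = dilation (Y - Z).
    by rewrite /dilation opp_block_mx add_block_mx !subr0 linearB.
  rewrite /dilation mulmx_block !mul0mx !mulmx0 !addr0 !add0r mxtrace_block.
  rewrite [\tr (_^T *m _)]mxtrace_mulC mulrDl !mul1r.
  have -> : \tr ((Y - Z) *m (Y - Z)^T) = \sum_i \sum_j (Y i j - Z i j) ^+ 2.
    apply: eq_bigr => i _; rewrite mxE; apply: eq_bigr => j _.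
    by rewrite !mxE expr2.
  by [].
move: EY EZ; set D := \sum_i _; set sY := \sum_(_ <- eigenvalues (dilation Y)) _.
set sZ := \sum_(_ <- eigenvalues (dilation Z)) _.
set s1 := \sum_(_ <- _) _; set s2 := \sum_j _.
rewrite -[h 0 *+ p]mulr_natr -[h 0 *+ n]mulr_natr -[s1 *+ 2]mulr_natr.
rewrite -[s2 *+ 2]mulr_natr natrD => EY EZ.
have -> : sY - sZ = 2 * (s1 - (s2 + h 0 * (p%:R - n%:R))) by lra.
rewrite normrM (ger0_norm (ler0n _ 2)).
set u := `| _ |; set w := p%:R + n%:R.
have D0 : 0 <= D by apply: sumr_ge0 => i _; apply: sumr_ge0 => j _; exact: sqr_ge0.
have : 0 <= L * (theta * w).
  by rewrite !mulr_ge0 ?(ltW t0)// /w addr_ge0.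
rewrite -(mulrA 2) !mulrDr.
lra.
Qed.

(** * Tails of slowly varying sequences *)

Lemma exprB_le (R : realDomainType) (n : nat) (x y : R) :
  0 <= y -> y <= x -> x ^+ n - y ^+ n <= n%:R * (x - y) * x ^+ n.-1.
Proof.
move=> y0 yx; rewrite subrXX mulrC mulrAC ler_wpM2r ?subr_ge0//.
have -> : n%:R * x ^+ n.-1 = \sum_(i < n) x ^+ n.-1.
  by rewrite sumr_const card_ord mulr_natl.
apply: ler_sum => i _.
have ni : (i <= n.-1)%N by rewrite -ltnS (ltn_predK (ltn_ord i)).
apply: le_trans (_ : x ^+ (n.-1 - i) * x ^+ i <= _).
  rewrite ler_wpM2l ?exprn_ge0 ?(le_trans y0)//.
  by rewrite lerXn2r ?nnegrE ?(le_trans y0).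
by rewrite -exprD subnK.
Qed.

Lemma expr_subr1_le (R : realFieldType) (n : nat) (y : R) :
  0 <= y -> y <= 1 -> (1 - y) ^+ n <= (1 + n%:R * y)^-1.
Proof.
move=> y0 y1; have ny : 0 <= n%:R * y by rewrite mulr_ge0.
rewrite -[leRHS]mul1r ler_pdivlMr ?ltr_wpDr//.
(* Bernoulli's inequality for (1 + y)^n, after which (1 - y^2)^n <= 1. *)
apply: le_trans (_ : (1 - y) ^+ n * (1 + y) ^+ n <= _).
  rewrite ler_wpM2l ?exprn_ge0 ?subr_ge0//.
  elim: n {ny} => [|n IH]; first by rewrite mul0r addr0 expr0.
  rewrite exprS; apply: le_trans (_ : (1 + y) * (1 + n%:R * y) <= _).
    rewrite -natr1; have : 0 <= n%:R * y * y by rewrite !mulr_ge0.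
    nra.
  by rewrite ler_wpM2l// addr_ge0.
by rewrite -exprMn exprn_ile1//; nra.
Qed.

Lemma exists_natr_gt (R : archiRealFieldType) (x : R) : exists n : nat, x < n%:R.
Proof. by exists (Num.trunc x).+1; exact: Num.Theory.truncnS_gt. Qed.

Section tail_sequence.
Context (R : realType) (t : nat -> R).
Hypothesis t_gt0 : forall k, 0 < t k.
Hypothesis t_le1 : forall k, t k <= 1.
Hypothesis t_noninc : forall k, t k.+1 <= t k.
Hypothesis t_cvg0 : forall e : R, 0 < e -> exists k, t k <= e.
Hypothesis t_ratio : forall e : R, 0 < e ->
  exists k0, forall k, (k0 <= k)%N -> t k <= (1 + e) * t k.+1.

(** With [t i] the probability that the level is at least [i], this is the mean of 4^level
    restricted to levels at most [k], a discrete truncated second moment. *)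
Definition level_moment (k : nat) : R :=
  \sum_(i < k.+1) 4 ^+ i * (t i - t i.+1).

Lemma level_moment_ge0 k : 0 <= level_moment k.
Proof.
by apply: sumr_ge0 => i _; rewrite mulr_ge0 ?exprn_ge0// subr_ge0.
Qed.

Let t_le k l : (k <= l)%N -> t l <= t k.
Proof.
move=> /subnK <-; elim: (l - k)%N => [//|j IH]; rewrite addSn.
exact: le_trans IH.
Qed.

(* Karamata: the truncated second moment is negligible with respect to
   4^k P(|xi| > 2^k). *)
Lemma level_moment_small (e : R) : 0 < e ->
  exists k0, forall k, (k0 <= k)%N -> level_moment k <= e * (4 ^+ k * t k.+1).
Proof.
move=> e0; pose d : R := Num.min 1 (e / 4).
have d0 : 0 < d by rewrite /d lt_min ltr01 divr_gt0.
have d1 : d <= 1 by rewrite /d ge_min lexx.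
have de : d <= e / 4 by rewrite /d ge_min lexx orbT.
clearbody d.
have [k1 k1P] := t_ratio d0.
pose D k := 4 ^+ k * t k.+1.
have D0 k : 0 < D k by rewrite /D mulr_gt0 ?exprn_gt0.
pose r := level_moment k1 / D k1.
have r0 : 0 <= r by rewrite divr_ge0 ?level_moment_ge0// ltW.
(* From one index to the next D grows by a factor at least 4 / (1 + d) >= 2, while the added term is
   at most d times the new D. The ratio thus obeys r' <= r / 2 + d, whose fixed point is 2 d <= e /
   2. *)
have rj j : level_moment (k1 + j) <= (r / 2 ^+ j + 2 * d) * D (k1 + j)%N.
  elim: j => [|j IH].
    rewrite addn0 expr0 divr1 mulrDl /r divfK ?gt_eqF// lerDl.
    by rewrite !mulr_ge0 ?ltW.
  rewrite addnS /level_moment big_ord_recr/= -/(level_moment _).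
  apply: le_trans (lerD IH (lexx _)) _.
  have := k1P (k1 + j).+1 (leq_trans (leq_addr _ _) (leqnSn _)).
  rewrite /D exprS; set l := (k1 + j)%N; set x : R := t l.+1; set y : R := t l.+2 => xy.
  rewrite exprSr invfM.
  have : 0 <= r / 2 ^+ j by rewrite divr_ge0// exprn_ge0.
  set u : R := r / 2 ^+ j => u0.
  have l0 : 0 < (4 : R) ^+ l by rewrite exprn_gt0.
  have y0 : 0 < y := t_gt0 _.
  rewrite (mulrA r) -/u [leLHS](_ : _ = 4 ^+ l * ((u + 2 * d) * x + 4 * (x - y))); last ring.
  rewrite [leRHS](_ : _ = 4 ^+ l * (4 * (u / 2 + 2 * d) * y)); last ring.
  rewrite ler_pM2l//; clearbody u x y.
  have h1 : (u + 2 * d) * x <= (u + 2 * d) * (2 * y).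
    have dy : d * y <= 1 * y by rewrite ler_pM2r.
    by rewrite ler_wpM2l//; lra.
  have := h1; lra.
have [j jP] := exists_natr_gt (r / (e / 2)).
exists (k1 + j)%N => k kj.
have -> : k = (k1 + (k - k1))%N by rewrite subnKC// (leq_trans (leq_addr _ _) kj).
apply: le_trans (rj _) _; rewrite -/(D _) ler_wpM2r ?(ltW (D0 _))//.
set v : R := r / _; suff : v <= e / 2 by lra.
rewrite /v.
rewrite ler_pdivrMr ?exprn_gt0// mulrC.
move: jP; rewrite ltr_pdivrMr ?divr_gt0// => /ltW/le_trans; apply.
rewrite ler_wpM2r ?divr_ge0 ?(ltW e0)//.
rewrite -natrX ler_nat; apply/ltnW/(leq_ltn_trans _ (ltn_expl _ _)) => //.
by rewrite leq_subRL// (leq_trans (leq_addr _ _) kj).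
Qed.

(** The k-th summand will bound from below the probability that a given column has level k + 1 and
    dominates. As the ratios of [t] tend to 1, n times its main part is nearly (1 - t_(k+2))^n - (1
    - t_(k+1))^n, and the sum telescopes to nearly 1. *)
Lemma dominant_lower_bound (N : nat) (e : R) : 0 < e ->
  exists n0, forall n M, (n0 <= n)%N -> n%:R ^+ 2 * t M <= 1 ->
  exists K, 1 - e <= n%:R * \sum_(K <= k < M.-1) (t k.+1 - t k.+2) *
    ((1 - t k.+1) ^+ n.-1 - n.-1%:R * (N%:R * (level_moment k / 4 ^+ k))).
Proof.
(* At the starting index n t lies between C / 2 and C: large enough for (1 - t)^n <= e / 4, yet
   bounded, so that the errors of all terms add up to at most G h. *)
move=> e0; pose C : R := 8 / e + 1.
have C1 : 1 <= C by rewrite lerDr divr_ge0// ltW.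
have C0 : 0 < C by exact: lt_le_trans C1.
have N1 : 0 < N%:R + 1 :> R by rewrite ltr_wpDl.
pose G : R := C ^+ 2 * (N%:R + 1).
have G0 : 0 < G by rewrite mulr_gt0// exprn_gt0.
pose h : R := Num.min (Num.min 1 (e / 4)) (e / 4 / G).
have h0 : 0 < h by rewrite /h !lt_min ltr01 !divr_gt0.
have h1 : h <= 1 by rewrite /h !ge_min lexx.
have he : h <= e / 4 by rewrite /h !ge_min lexx orbT.
have hG : G * h <= e / 4.
  by rewrite mulrC -ler_pdivlMr// /h !ge_min lexx !orbT.
have [k1 k1P] := t_ratio h0.
have [k2 k2P] := level_moment_small h0.
pose k0 := maxn k1 k2.
have [n1 n1P] := exists_natr_gt (C / t k0.+1).
have [n2 n2P] := exists_natr_gt h^-1.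
exists (maxn 1 (maxn n1 n2)) => n M.
rewrite !geq_max => /and3P[n0 nn1 nn2] tM.
have nR0 : 0 < n%:R :> R by rewrite ltr0n.
have Cn : C < n%:R * t k0.+1.
  rewrite -ltr_pdivrMr//; apply: lt_le_trans n1P _; by rewrite ler_nat.
have hn : 1 <= h * n%:R.
  rewrite mulrC -ler_pdivrMr// mul1r; apply/ltW/(lt_le_trans n2P).
  by rewrite ler_nat.
(* K is the first such index. Minimality gives C < n t_K, and [t] loses at most a factor 1 + h <= 2
   in one step, as K exceeds k0 for large n. *)
have exK : exists k, n%:R * t k.+1 <= C.
  have [k kP] := t_cvg0 (divr_gt0 C0 nR0).
  exists k; rewrite mulrC -ler_pdivlMr//; exact: le_trans kP.
pose K := ex_minn exK; exists K.
have [KC Kmin] : n%:R * t K.+1 <= C /\ forall k, n%:R * t k.+1 <= C -> (K <= k)%N.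
  by rewrite /K; case: ex_minnP.
have k0K : (k0 < K)%N.
  rewrite ltnNge; apply/negP => /ltnSE; rewrite -ltnS => Kk.
  have := le_trans (ler_wpM2l (ltW nR0) (t_le Kk)) KC.
  by rewrite leNgt Cn.
have KC' : C < n%:R * t K.
  rewrite ltNge; apply/negP; case: (K) k0K Kmin => // l _ Kmin' /Kmin'.
  by rewrite ltnn.
have KC2 : C <= 2 * (n%:R * t K.+1).
  have tK : t K <= (1 + h) * t K.+1.
    apply: k1P; apply: leq_trans (ltnW k0K); exact: leq_maxl.
  apply: (le_trans (ltW KC')).
  apply: (le_trans (ler_wpM2l (ltW nR0) tK)).
  have : 0 <= (1 - h) * (n%:R * t K.+1).
    by rewrite mulr_ge0 ?subr_ge0// mulr_ge0// ltW.
  lra.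
have ntM : n%:R * t M <= h.
  rewrite -(ler_pM2l nR0) mulrA -expr2 (le_trans tM)// mulrC//.
have KM : (K < M)%N.
  rewrite ltnNge; apply/negP => MK; have := ler_wpM2l (ltW nR0) (t_le MK).
  lra.
(* Two errors per term: C h for replacing 1 - t_(k+2) by 1 - t_(k+1) under the power ([Y]), and C h
   N for the Karamata correction ([Z]). *)
have term k : (K <= k)%N ->
  (1 - t k.+2) ^+ n - (1 - t k.+1) ^+ n - n%:R * (t k.+1 - t k.+2) * (C * h * (N%:R + 1))
  <= n%:R * ((t k.+1 - t k.+2) *
    ((1 - t k.+1) ^+ n.-1 - n.-1%:R * (N%:R * (level_moment k / 4 ^+ k)))).
  move=> Kk.
  have yC : n%:R * t k.+1 <= C.
    by apply: le_trans KC; rewrite ler_wpM2l ?(ltW nR0)// t_le.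
  have xy := t_noninc k.+1.
  have yx : t k.+1 <= (1 + h) * t k.+2.
    apply: k1P; apply: leq_trans (leqW Kk); apply: leq_trans (ltnW k0K).
    exact: leq_maxl.
  have mk : level_moment k / 4 ^+ k <= h * t k.+1.
    rewrite ler_pdivrMr ?exprn_gt0// mulrAC -mulrA; apply: k2P.
    apply: leq_trans Kk; apply: leq_trans (ltnW k0K); exact: leq_maxr.
  have mk0 : 0 <= level_moment k / 4 ^+ k.
    by rewrite divr_ge0 ?level_moment_ge0// exprn_ge0.
  move: mk mk0 xy yx yC (t_gt0 k.+2) (t_le1 k.+1) (t_le1 k.+2).
  set m : R := _ / _; set x : R := t k.+2; set y : R := t k.+1 => mk mk0 xy yx yC x0 y1 x1.
  have X : (1 - x) ^+ n - (1 - y) ^+ n <= n%:R * (y - x) * (1 - x) ^+ n.-1.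
    have := @exprB_le _ n (1 - x) (1 - y).
    rewrite (_ : 1 - x - (1 - y) = y - x); last ring.
    by apply; lra.
  have Y : (1 - x) ^+ n.-1 - (1 - y) ^+ n.-1 <= C * h.
    have := @exprB_le _ n.-1 (1 - x) (1 - y).
    rewrite (_ : 1 - x - (1 - y) = y - x); last ring.
    move=> H; have {H} := H _ _.
    have p1 : (1 - x) ^+ n.-1.-1 <= 1 by rewrite exprn_ile1//; lra.
    move=> H; have {}H := H ltac:(lra) ltac:(lra).
    apply: (le_trans H).
    have q1 : n.-1%:R * (y - x) * (1 - x) ^+ n.-1.-1 <= n.-1%:R * (y - x).
      rewrite -[leRHS]mulr1 ler_wpM2l// mulr_ge0//; lra.
    apply: (le_trans q1).
    have q2 : n.-1%:R * (y - x) <= n%:R * (y - x).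
      rewrite ler_wpM2r ?subr_ge0// ler_nat leq_pred//.
    apply: (le_trans q2).
    apply: le_trans (_ : n%:R * (h * y) <= _).
      by rewrite ler_wpM2l ?(ltW nR0)//; nra.
    by rewrite mulrCA mulrC ler_wpM2r ?(ltW h0).
  have Z : n.-1%:R * (N%:R * m) <= C * h * N%:R.
    apply: le_trans (_ : n%:R * (N%:R * (h * y)) <= _).
      apply: ler_pM => //; first by rewrite mulr_ge0.
        by rewrite ler_nat leq_pred.
      by rewrite ler_wpM2l.
    rewrite [leLHS](_ : _ = (n%:R * y) * (h * N%:R)); last ring.
    by rewrite -[leRHS]mulrA ler_wpM2r// mulr_ge0// ltW.
  rewrite [leRHS]mulrA.
  have nyx : 0 <= n%:R * (y - x) by rewrite mulr_ge0// subr_ge0.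
  move: nyx X; set w : R := n%:R * (y - x); move: Y Z.
  set A : R := (1 - x) ^+ n.-1; set B : R := (1 - y) ^+ n.-1; set Q : R := n.-1%:R * _.
  move=> Y Z nyx X.
  have : w * (A - C * h * (N%:R + 1)) <= w * (B - Q).
    by rewrite ler_wpM2l//; lra.
  move: X; set P1 : R := _ ^+ n; set P2 : R := _ ^+ n => X.
  clearbody A B w Q P1 P2 C h; lra.
have lower : (1 - t M) ^+ n - (1 - t K.+1) ^+ n
    - n%:R * (t K.+1 - t M) * (C * h * (N%:R + 1)) <=
    n%:R * \sum_(K <= k < M.-1) (t k.+1 - t k.+2) *
    ((1 - t k.+1) ^+ n.-1 - n.-1%:R * (N%:R * (level_moment k / 4 ^+ k))).
  rewrite mulr_sumr.
  pose f k := (1 - t k.+1) ^+ n; pose g k := - t k.+1.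
  have KM' : (K <= M.-1)%N by rewrite -ltnS (ltn_predK KM).
  have MS : M = M.-1.+1 by rewrite (ltn_predK KM).
  rewrite [leLHS](_ : _ = \sum_(K <= k < M.-1) (f k.+1 - f k
     - n%:R * (g k.+1 - g k) * (C * h * (N%:R + 1)))); last first.
    rewrite sumrB -mulr_suml -mulr_sumr !telescope_sumr//.
    by rewrite /f /g -MS; congr (_ - _ * _ * _); ring.
  apply: ler_sum_nat => k /andP[Kk _].
  rewrite /f /g (_ : - t k.+2 - - t k.+1 = t k.+1 - t k.+2); last ring.
  exact: term.
apply: le_trans lower.
have b1 : 1 - h <= (1 - t M) ^+ n.
  have := @exprB_le _ n 1 (1 - t M).
  rewrite !expr1n mulr1 subKr => H.
  have tM0 := t_gt0 M; have tM1 := t_le1 M.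
  have {}H := H ltac:(lra) ltac:(lra); lra.
have b2 : (1 - t K.+1) ^+ n <= e / 4.
  apply: (le_trans (expr_subr1_le _ (ltW (t_gt0 _)) (t_le1 _))).
  rewrite -[leLHS]mul1r ler_pdivrMr ?ltr_wpDr ?mulr_ge0 ?ltW//.
  have eC : 8 <= e * C by rewrite /C mulrDr mulrCA divff ?gt_eqF//; lra.
  have : e * C <= e * (2 * (n%:R * t K.+1)) by rewrite ler_pM2l.
  by nra.
have b3 : n%:R * (t K.+1 - t M) * (C * h * (N%:R + 1)) <= e / 4.
  apply: le_trans hG.
  rewrite [leRHS](_ : _ = C * (C * h * (N%:R + 1))); last by rewrite /G; ring.
  rewrite ler_wpM2r ?mulr_ge0 ?(ltW C0) ?(ltW h0) ?(ltW N1)//.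
  apply: le_trans KC; rewrite ler_wpM2l ?(ltW nR0)//.
  by have := t_gt0 M; lra.
lra.
Qed.

End tail_sequence.

(** * Polynomial approximation *)

(** Bernstein polynomial of the values g 0, ..., g m in de Casteljau form: at u it is the mean of g
    at a binomial variable, computed by conditioning on one toss. Mean and variance then follow by
    induction without binomial coefficients. *)
Fixpoint bernstein (R : nzRingType) (m : nat) (g : nat -> R) : {poly R} :=
  if m is m'.+1 then (1 - 'X) * bernstein m' g + 'X * bernstein m' (g \o succn)
  else (g 0%N)%:P.

Section bernstein.
Context (R : realType) (u : R).
Hypothesis u01 : 0 <= u <= 1.

Lemma bernsteinS m g : (bernstein m.+1 g).[u] =
  (1 - u) * (bernstein m g).[u] + u * (bernstein m (g \o succn)).[u].
Proof. by rewrite /= !hornerE. Qed.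

Lemma bernsteinD m g h : (bernstein m (fun k => g k + h k)).[u] =
  (bernstein m g).[u] + (bernstein m h).[u].
Proof.
elim: m g h => [|m IH] g h; first by rewrite /= !hornerE.
rewrite !bernsteinS !(IH, IH (g \o succn) (h \o succn)); ring.
Qed.

Lemma bernsteinZ m c g : (bernstein m (fun k => c * g k)).[u] =
  c * (bernstein m g).[u].
Proof.
elim: m g => [|m IH] g; first by rewrite /= !hornerE.
rewrite !bernsteinS !(IH, IH (g \o succn)); ring.
Qed.

Lemma bernstein_cst m c : (bernstein m (fun=> c)).[u] = c.
Proof.
elim: m => [|m IH]; first by rewrite /= !hornerE.
by rewrite bernsteinS IH; ring.
Qed.

Lemma bernstein_le m g h : (forall k, (k <= m)%N -> g k <= h k) ->
  (bernstein m g).[u] <= (bernstein m h).[u].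
Proof.
move: u01 => /andP[u0 u1].
elim: m g h => [|m IH] g h gh; first by rewrite /= !hornerE gh.
rewrite !bernsteinS lerD// ler_wpM2l ?subr_ge0// IH// => k km.
- by rewrite gh// leqW.
- by rewrite gh.
Qed.

Lemma bernstein_mean m : (bernstein m (fun k => k%:R)).[u] = m%:R * u.
Proof.
elim: m => [|m IH]; first by rewrite /= hornerC mul0r.
have E : (fun k => k%:R : R) \o succn = fun k => 1 + k%:R.
  by apply/funext => k /=; rewrite -natr1 addrC.
rewrite bernsteinS E (bernsteinD _ (fun=> 1)) bernstein_cst IH -natr1; ring.
Qed.

Lemma bernstein_variance m :
  (bernstein m (fun k => (k%:R - m%:R * u) ^+ 2)).[u] = m%:R * (u * (1 - u)).
Proof.
have E2 : (bernstein m (fun k => k%:R ^+ 2)).[u] = m%:R * (u * (1 - u)) + (m%:R * u) ^+ 2.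
  elim: m => [|m IH]; first by rewrite /= !hornerE; ring.
  have E : (fun k => k%:R ^+ 2 : R) \o succn = fun k => (1 + 2 * k%:R) + k%:R ^+ 2.
    by apply/funext => k /=; rewrite -natr1; ring.
  rewrite bernsteinS E (bernsteinD _ (fun k => 1 + 2 * k%:R)) (bernsteinD _ (fun=> 1)).
  rewrite bernsteinZ bernstein_mean bernstein_cst IH -natr1; ring.
have -> : (fun k => (k%:R - m%:R * u) ^+ 2) =
    fun k => (k%:R ^+ 2 + (- (2 * (m%:R * u))) * k%:R) + (m%:R * u) ^+ 2.
  by apply/funext => k; ring.
rewrite (bernsteinD _ (fun k => k%:R ^+ 2 + _ * k%:R)) bernstein_cst.
by rewrite bernsteinD E2 bernsteinZ bernstein_mean; ring.
Qed.

End bernstein.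

Lemma unit_segment_unif_continuous (R : realType) (f : R -> R) (e : R) :
  continuous f -> 0 < e ->
  exists2 d, 0 < d & forall x y, 0 <= x <= 1 -> `|x - y| < d -> `|f x - f y| < e.
Proof.
move=> cf e0.
have /compact_near_coveringP K := @segment_compact R 0 1.
have := K _ (0^'+) (fun d x => forall y, `|x - y| < d -> `|f x - f y| < e) _.
case=> [x x01|d /= d0 dP].
  have /cvgrPdist_lt/(_ (e / 2)) := cf x.
  rewrite divr_gt0// => /(_ isT)/nbhs_ballP[r /= r0 rP].
  have r2 : 0 < r / 2 by rewrite divr_gt0.
  exists (ball x (r / 2), [set d | d < r / 2]) => /=.
    split; first exact: nbhsx_ballx.
    exact: nbhs_right_lt.
  move=> [z d] [/= zx dr] y zy.
  have h1 : `|f x - f z| < e / 2.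
    by apply: rP; rewrite /ball/=; move: zx; rewrite /ball/=; lra.
  have h2 : `|f x - f y| < e / 2.
    apply: rP; rewrite /ball/=; move: zx; rewrite /ball/= => zx.
    have -> : x - y = (x - z) + (z - y) by ring.
    by apply: le_lt_trans (ler_normD _ _) _; lra.
  have -> : f z - f y = (f x - f y) - (f x - f z) by ring.
  by apply: le_lt_trans (ler_normB _ _) _; lra.
have d2 : 0 < d / 2 by rewrite divr_gt0.
exists (d / 2) => // x y x01.
apply: dP => //=.
by rewrite sub0r normrN gtr0_norm// ltr_pdivrMr//; lra.
Qed.

(** Bernstein's proof: the quadratic bound [pw] is averaged, and the variance u (1 - u) / m makes
    its second term small. *)
Lemma weierstrass_approximation (R : realType) (f : R -> R) (B e : R) :
  continuous f -> (forall x, `|f x| <= B) -> 0 < e ->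
  exists Q : {poly R}, forall u, 0 <= u <= 1 -> `|f u - Q.[u]| <= e.
Proof.
move=> cf fB e0.
have B0 : 0 <= B by exact: le_trans (fB 0).
have e2 : 0 < e / 2 by rewrite divr_gt0.
have [d d0 dP] := unit_segment_unif_continuous cf e2.
(* Beyond distance d the crude bound 2 B is at most c times the squared distance. *)
pose c := 2 * B / d ^+ 2.
have c0 : 0 <= c by rewrite divr_ge0 ?sqr_ge0// mulr_ge0.
have [m mP] := exists_natr_gt (c / (e / 2)).
have m0 : 0 < m%:R :> R by apply: le_lt_trans mP; rewrite divr_ge0// ltW.
have mN : m%:R != 0 :> R by rewrite gt_eqF.
exists (bernstein m (fun k => f (k%:R / m%:R))) => u u01.
have pw k : `|f (k%:R / m%:R) - f u| <= e / 2 + c / m%:R ^+ 2 * (k%:R - m%:R * u) ^+ 2.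
  have -> : c / m%:R ^+ 2 * (k%:R - m%:R * u) ^+ 2 = c * (u - k%:R / m%:R) ^+ 2.
    by field.
  have [lt_d|ge_d] := ltP `|u - k%:R / m%:R| d.
    rewrite distrC (le_trans (ltW (dP _ _ u01 lt_d)))// lerDl.
    by rewrite mulr_ge0 ?sqr_ge0.
  apply: le_trans (_ : 2 * B <= _).
    by apply: le_trans (ler_normB _ _) _; have := fB (k%:R / m%:R); have := fB u; lra.
  apply: le_trans (_ : c * d ^+ 2 <= _).
    by rewrite /c divfK// expf_neq0 ?gt_eqF.
  have : c * d ^+ 2 <= c * (u - k%:R / m%:R) ^+ 2.
    rewrite ler_wpM2l// -[leRHS]real_normK ?num_real//.
    by rewrite lerXn2r ?nnegrE ?normr_ge0 ?(ltW d0).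
  by lra.
rewrite distrC.
have -> : (bernstein m (fun k => f (k%:R / m%:R))).[u] - f u =
    (bernstein m (fun k => f (k%:R / m%:R) - f u)).[u].
  by rewrite (bernsteinD _ _ _ (fun=> - f u)) bernstein_cst.
have bnd : (bernstein m (fun k => e / 2 + c / m%:R ^+ 2 * (k%:R - m%:R * u) ^+ 2)).[u] <= e.
  rewrite (bernsteinD _ _ (fun=> _)) bernstein_cst bernsteinZ bernstein_variance.
  have -> : c / m%:R ^+ 2 * (m%:R * (u * (1 - u))) = c / m%:R * (u * (1 - u)) by field.
  have : c / m%:R <= e / 2.
    by rewrite ler_pdivrMr// mulrC -ler_pdivrMr//; exact: ltW.
  have : 0 <= c / m%:R by rewrite divr_ge0// ltW.
  by move: u01 => /andP[u0 u1]; nra.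
rewrite ler_norml; apply/andP; split.
  rewrite lerNl -mulN1r -bernsteinZ; apply: le_trans bnd.
  apply: bernstein_le => // k _; apply: le_trans (pw k).
  by rewrite mulN1r -normrN ler_norm.
apply: le_trans bnd; apply: bernstein_le => // k _.
by apply: le_trans (pw k); rewrite ler_norm.
Qed.

(** In the variable u = exp(- x), f need not extend continuously to u = 0, so it is frozen beyond x
    = K. There the error 2 B is less than e x, which explains the weight 1 + x; both measures
    integrate this weight to at most 2. *)
Lemma exponential_approximation (R : realType) (f : R -> R) (B e : R) :
  continuous f -> (forall x, `|f x| <= B) -> 0 < e ->
  exists Q : {poly R}, forall x, 0 <= x ->
    `|f x - Q.[expR (- x)]| <= e * (1 + x).
Proof.
move=> cf fB e0.
have B0 : 0 <= B by exact: le_trans (fB 0).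
pose K := 2 * B / e; have K0 : 0 <= K by rewrite divr_ge0 ?mulr_ge0// ltW.
pose g u := f (- ln (Num.max u (expR (- K)))).
have cg : continuous g.
  move=> u; rewrite /g.
  apply: (@continuous_comp _ _ _ (fun u => - ln (Num.max u (expR (- K)))) f); last exact: cf.
  apply: cvgN; apply: (@continuous_comp _ _ _ (fun u => Num.max u (expR (- K))) (@ln R)).
    by apply: continuous_max; [exact: cvg_id|exact: cvg_cst].
  by apply: continuous_ln; rewrite lt_max expR_gt0 orbT.
have [Q QP] := weierstrass_approximation cg (fun u => fB _) e0.
exists Q => x x0.
have E01 : 0 <= expR (- x) <= 1.
  by rewrite expR_ge0/= -expR0 ler_expR oppr_le0.
have := QP _ E01; rewrite /g.
have [xK|Kx] := leP x K.
  rewrite max_l ?ler_expR ?lerN2// expRK opprK => /le_trans; apply.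
  by rewrite ler_peMr ?(ltW e0)// lerDl.
move=> H.
set y := - ln _ in H.
have -> : f x - Q.[expR (- x)] = f x - f y + (f y - Q.[expR (- x)]) by ring.
apply: le_trans (ler_normD _ _) _; rewrite mulrDr mulr1 addrC lerD//.
apply: le_trans (ler_normB _ _) _.
apply: le_trans (lerD (fB _) (fB _)) _.
have : 2 * B < e * x by rewrite (mulrC e) -ltr_pdivrMr.
by lra.
Qed.

(** * Dominant columns in finite product spaces *)

Definition prod_weight (R : comNzRingType) (J W : finType) (mu : W -> R)
  (v : {ffun J -> W}) : R := \prod_j mu (v j).
Arguments prod_weight {R} J {W} mu v.

Definition fin_mean (R : comNzRingType) (W : finType) (mu F : W -> R) : R :=
  \sum_w F w * mu w.

Section fin_mean.
Context (R : realFieldType) (W : finType) (mu : W -> R).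
Hypothesis mu_ge0 : forall w, 0 <= mu w.
Hypothesis mu_sum1 : \sum_w mu w = 1.

Lemma fin_mean_cst c : fin_mean mu (fun=> c) = c.
Proof. by rewrite /fin_mean -mulr_sumr mu_sum1 mulr1. Qed.

Lemma fin_meanD F G :
  fin_mean mu (fun w => F w + G w) = fin_mean mu F + fin_mean mu G.
Proof. by rewrite /fin_mean -big_split; apply: eq_bigr => w _; rewrite mulrDl. Qed.

Lemma fin_meanZ c F : fin_mean mu (fun w => c * F w) = c * fin_mean mu F.
Proof. by rewrite /fin_mean mulr_sumr; apply: eq_bigr => w _; rewrite mulrA. Qed.

Lemma fin_mean_sum (I : Type) (r : seq I) (P : pred I) (F : I -> W -> R) :
  fin_mean mu (fun w => \sum_(i <- r | P i) F i w) =
  \sum_(i <- r | P i) fin_mean mu (F i).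
Proof.
by rewrite /fin_mean exchange_big; apply: eq_bigr => w _; rewrite mulr_suml.
Qed.

Lemma fin_mean_le F G : (forall w, F w <= G w) -> fin_mean mu F <= fin_mean mu G.
Proof. by move=> FG; apply: ler_sum => w _; rewrite ler_wpM2r. Qed.

Lemma fin_mean_ge0 F : (forall w, 0 <= F w) -> 0 <= fin_mean mu F.
Proof. by move=> F0; apply: sumr_ge0 => w _; rewrite mulr_ge0. Qed.

Lemma fin_markov (A : pred W) F :
  (forall w, 0 <= F w) -> (forall w, A w -> 1 <= F w) ->
  \sum_(w | A w) mu w <= fin_mean mu F.
Proof.
move=> F0 F1; rewrite big_mkcond; apply: ler_sum => w _.
case: ifPn => Aw; last by rewrite mulr_ge0.
by rewrite ler_peMl ?F1.
Qed.

Lemma prod_weight_ge0 (J : finType) (v : {ffun J -> W}) : 0 <= prod_weight J mu v.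
Proof. exact: prodr_ge0. Qed.

Lemma fin_mean_prod (J : finType) (g : J -> W -> R) :
  fin_mean (prod_weight J mu) (fun v : {ffun J -> W} => \prod_j g j (v j)) =
  \prod_j fin_mean mu (g j).
Proof.
rewrite bigA_distr_bigA; apply: eq_bigr => v _.
by rewrite /prod_weight -big_split.
Qed.

Lemma prod_weight_sum1 (J : finType) :
  \sum_(v : {ffun J -> W}) prod_weight J mu v = 1.
Proof.
transitivity (fin_mean (prod_weight J mu) (fun v : {ffun J -> W} => \prod_(j : J) (1 : R))).
  by apply: eq_bigr => v _; rewrite big1 ?mul1r.
by rewrite (fin_mean_prod (fun _ _ => 1)) big1// => j _; exact: fin_mean_cst.
Qed.

Lemma fin_mean_coord (J : finType) (j : J) (g : W -> R) :
  fin_mean (prod_weight J mu) (fun v : {ffun J -> W} => g (v j)) = fin_mean mu g.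
Proof.
transitivity (fin_mean (prod_weight J mu) (fun v : {ffun J -> W} =>
    \prod_i (if i == j then g (v i) else 1))).
  apply: eq_bigr => v _; congr (_ * _).
  by rewrite -big_mkcond big_pred1_eq.
rewrite (fin_mean_prod (fun i w => if i == j then g w else 1)).
rewrite (bigD1 j)//= eqxx big1 ?mulr1// => i /negPf ->.
exact: fin_mean_cst.
Qed.

End fin_mean.

Section level_pmf.
Context (R : realType) (t : nat -> R) (M : nat).
Hypothesis t0 : t 0%N = 1.
Hypothesis t_ge0 : forall k, 0 <= t k.
Hypothesis t_noninc : forall k, t k.+1 <= t k.

(** Law of a level capped at [M]: the top level takes all the remaining mass [t M]. *)
Definition level_pmf (i : 'I_M.+1) : R :=
  t i - (if i == M :> nat then 0 else t i.+1).

Lemma level_pmf_ge0 i : 0 <= level_pmf i.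
Proof. by rewrite /level_pmf; case: ifP => _; rewrite ?subr0// subr_ge0. Qed.

Lemma sum_level_pmf_le k : (k < M)%N ->
  \sum_(i : 'I_M.+1 | (i <= k)%N) level_pmf i = 1 - t k.+1.
Proof.
move=> kM; transitivity (\sum_(0 <= i < k.+1) (t i - t i.+1)); last first.
  have := telescope_sumr (fun i => - t i) (leq0n k.+1); rewrite t0 => E.
  transitivity (- t k.+1 - - 1); last ring.
  by rewrite -E; apply: eq_bigr => i _; ring.
rewrite (big_nat_widen _ _ M.+1) ?(leqW kM)// big_mkord; apply: eq_bigr => i.
by rewrite /level_pmf => ik; rewrite (ltn_eqF (leq_ltn_trans ik kM)).
Qed.

Lemma sum_level_pmf_moment k : (k < M)%N ->
  \sum_(i : 'I_M.+1 | (i <= k)%N) 4 ^+ i * level_pmf i = level_moment t k.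
Proof.
move=> kM; rewrite /level_moment.
rewrite -(big_mkord xpredT (fun i => 4 ^+ i * (t i - t i.+1))).
rewrite (big_nat_widen _ _ M.+1) ?(leqW kM)// big_mkord; apply: eq_bigr => i.
by rewrite /level_pmf => ik; rewrite (ltn_eqF (leq_ltn_trans ik kM)).
Qed.

Lemma sum_level_pmf : \sum_i level_pmf i = 1.
Proof.
transitivity (\sum_(0 <= i < M.+1) (t i - (if i == M then 0 else t i.+1))).
  by rewrite big_mkord.
rewrite big_nat_recr//= eqxx subr0 -t0.
have := telescope_sumr (fun i => - t i) (leq0n M) => E.
transitivity (- t M - - t 0%N + t M); last ring.
rewrite -E; congr (_ + _); apply: eq_big_nat => i /andP[_ iM].
by rewrite (ltn_eqF iM); ring.
Qed.

End level_pmf.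

(* Row [v] of levels: [dominant N v j] forces the square of the [j]-th entry to
   exceed [N] times the sum of the squares of the others. *)
Definition dominant (N n M : nat) (v : {ffun 'I_n -> 'I_M.+1}) (j : 'I_n) : bool :=
  (N * \sum_(l | l != j) 4 ^ (v l).+1 <= 4 ^ v j)%N.

Lemma dominant_lt (N n M : nat) (v : {ffun 'I_n -> 'I_M.+1}) (j l : 'I_n) :
  (0 < N)%N -> dominant N v j -> l != j -> (v l < v j)%N.
Proof.
move=> N0 vj lj; rewrite -(ltn_exp2l _ _ (isT : 1 < 4)%N).
apply: leq_trans vj; apply: leq_trans (leq_pmull _ N0).
rewrite (bigD1 l)//=; apply: leq_trans (leq_addr _ _).
by rewrite ltn_exp2l.
Qed.

Lemma dominant_inj (N n M : nat) (v : {ffun 'I_n -> 'I_M.+1}) (j l : 'I_n) :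
  (0 < N)%N -> dominant N v j -> dominant N v l -> j = l.
Proof.
move=> N0 vj vl; apply/eqP/negPn/negP => jl.
have := dominant_lt N0 vl jl; rewrite ltnNge ltnW//.
by apply: dominant_lt vj _ => //; rewrite eq_sym.
Qed.

Section dominant_prob.
Context (R : realType) (N n M : nat).
Hypothesis N0 : (0 < N)%N.
Local Notation row := {ffun 'I_n -> 'I_M.+1}.

Lemma sum_dominant_le1 (v : row) : \sum_j (dominant N v j)%:R <= 1 :> R.
Proof.
have [[j vj]|nv] := pselect (exists j, dominant N v j).
  rewrite (bigD1 j)//= vj big1 ?addr0// => l lj.
  rewrite (_ : dominant N v l = false)//; apply/negP => vl.
  by move/eqP: lj; apply; exact: dominant_inj vl vj.
rewrite big1// => j _; case: (boolP (dominant N v j)) => // vj.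
by exfalso; apply: nv; exists j.
Qed.

Section weights.
Context (mu : 'I_M.+1 -> R).
Hypothesis mu_ge0 : forall w, 0 <= mu w.
Hypothesis mu_sum1 : \sum_w mu w = 1.

Definition dominant_prob (j : 'I_n) : R :=
  fin_mean (prod_weight 'I_n mu) (fun v : row => (dominant N v j)%:R).

Lemma dominant_prob_exchangeable (j l : 'I_n) :
  dominant_prob j = dominant_prob l.
Proof.
pose s := tperm j l.
pose h (v : row) : row := [ffun i => v (s i)].
have hK : involutive h by move=> v; apply/ffunP => i; rewrite !ffunE /s tpermK.
rewrite /dominant_prob /fin_mean (reindex_inj (inv_inj hK))/=.
apply: eq_bigr => v _; congr (_%:R * _).
  rewrite /dominant !ffunE /s tpermL; congr (_ * _ <= _)%N.
  rewrite (reindex_inj (@perm_inj _ s))/=; apply: eq_big => i.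
    by rewrite -(inj_eq (@perm_inj _ s)) tpermK /s tpermL.
  by rewrite !ffunE tpermK.
rewrite /prod_weight (reindex_inj (@perm_inj _ s))/=.
by apply: eq_bigr => i _; rewrite ffunE tpermK.
Qed.

End weights.

Context (t : nat -> R).
Hypothesis t0 : t 0%N = 1.
Hypothesis t_ge0 : forall k, 0 <= t k.
Hypothesis t_noninc : forall k, t k.+1 <= t k.
Let mu := @level_pmf R t M.
Let mu_ge0 : forall w, 0 <= mu w := level_pmf_ge0 t_ge0 t_noninc.
Let mu_sum1 : \sum_w mu w = 1 := sum_level_pmf M t0.

(** When the j-th level is k + 1, the product vanishes if another level exceeds k; otherwise failure
    of domination forces the subtracted sum to be at least 1, as in Markov's inequality. The left
    side is a combination of products of functions of single coordinates, so its mean is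
    explicit. *)
Lemma dominant_indicator_ge (v : row) (j : 'I_n) (k : nat) :
  (v j == k.+1 :> nat)%:R * (\prod_(l | l != j) (v l <= k)%N%:R
    - \sum_(l | l != j) N%:R / 4 ^+ k * (4 ^+ v l * (v l <= k)%N%:R))
  <= (v j == k.+1 :> nat)%:R * (dominant N v j)%:R :> R.
Proof.
have [vj|_] := eqVneq (v j : nat) k.+1; last by rewrite !mul0r.
rewrite !mul1r.
have S0 : 0 <= \sum_(l | l != j) N%:R / 4 ^+ k * (4 ^+ v l * (v l <= k)%N%:R) :> R.
  apply: sumr_ge0 => l _; rewrite !mulr_ge0// ?invr_ge0 exprn_ge0//.
have [all_le|] := boolP [forall l, (l != j) ==> (v l <= k)%N]; last first.
  rewrite negb_forall => /existsP[l]; rewrite negb_imply => /andP[lj vl].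
  rewrite (bigD1 l)//= (negPf vl) mul0r sub0r.
  by apply: le_trans (ler0n _ _); rewrite oppr_le0.
have le_k l : l != j -> (v l <= k)%N by move/forallP/(_ l)/implyP : all_le; exact.
rewrite big1 => [|l /le_k ->//].
have [|ndom] := boolP (dominant N v j); first by rewrite lerBlDr lerDl.
rewrite subr_le0; move: ndom; rewrite /dominant -ltnNge vj => ndom.
have -> : \sum_(l | l != j) N%:R / 4 ^+ k * (4 ^+ v l * (v l <= k)%N%:R) =
    (N * \sum_(l | l != j) 4 ^ (v l).+1)%N%:R / 4 ^+ k.+1 :> R.
  rewrite natrM natr_sum mulr_sumr mulr_suml; apply: eq_bigr => l /le_k ->.
  by rewrite mulr1 natrX !exprS; field; rewrite expf_neq0.
by rewrite ler_pdivlMr ?exprn_gt0// mul1r -natrX ler_nat ltnW.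
Qed.

Lemma dominant_prob_ge (j : 'I_n) (K : nat) :
  \sum_(K <= k < M.-1) (t k.+1 - t k.+2) *
    ((1 - t k.+1) ^+ n.-1 - n.-1%:R * (N%:R * (level_moment t k / 4 ^+ k)))
  <= dominant_prob mu j.
Proof.
pose G k (v : row) : R := (v j == k.+1 :> nat)%:R * (\prod_(l | l != j) (v l <= k)%N%:R
    - \sum_(l | l != j) N%:R / 4 ^+ k * (4 ^+ v l * (v l <= k)%N%:R)).
have cardn : #|[pred l | l != j]| = n.-1 by rewrite (cardC1 j) card_ord.
have GE k : (k < M.-1)%N -> fin_mean (prod_weight 'I_n mu) (G k) =
    (t k.+1 - t k.+2) *
    ((1 - t k.+1) ^+ n.-1 - n.-1%:R * (N%:R * (level_moment t k / 4 ^+ k))).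
  (* The range stops at [M.-1] so that level k + 1 lies strictly below the cap and has mass t_(k+1)
     - t_(k+2). *)
  move=> kM; have kM1 : (k.+1 < M)%N by rewrite -ltn_predRL.
  have kM2 : (k.+1 < M.+1)%N by rewrite ltnW.
  have muk : fin_mean mu (fun w : 'I_M.+1 => (w == k.+1 :> nat)%:R) = t k.+1 - t k.+2.
    rewrite /fin_mean (bigD1 (Ordinal kM2))//= eqxx mul1r big1 ?addr0.
      by rewrite /mu /level_pmf/= (ltn_eqF kM1).
    move=> w wk; case: eqP => [wE|]; last by rewrite mul0r.
    by case/eqP: wk; apply/val_inj.
  have muF : fin_mean mu (fun w : 'I_M.+1 => (w <= k)%N%:R) = 1 - t k.+1.
    rewrite -(@sum_level_pmf_le _ _ M)// 1?ltnW// [RHS]big_mkcond; apply: eq_bigr => w _.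
    by case: ifP => _; rewrite ?mul1r ?mul0r.
  have muM : fin_mean mu (fun w : 'I_M.+1 => 4 ^+ w * (w <= k)%N%:R) = level_moment t k.
    rewrite -(@sum_level_pmf_moment _ _ M)// 1?ltnW// [RHS]big_mkcond; apply: eq_bigr => w _.
    by case: ifP => _; rewrite ?mulr1 ?mulr0 ?mul0r.
  transitivity (fin_mean (prod_weight 'I_n mu) (fun v : row =>
      \prod_l (if l == j then (v l == k.+1 :> nat)%:R else (v l <= k)%N%:R)
    + (- (N%:R / 4 ^+ k)) * \sum_(l | l != j) \prod_i
       (if i == j then (v i == k.+1 :> nat)%:R else
        if i == l then 4 ^+ v i * (v i <= k)%N%:R else 1))).
    apply: eq_bigr => v _; congr (_ * _); rewrite /G mulrBr; congr (_ + _).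
      rewrite [RHS](bigD1 j)//= eqxx; congr (_ * _); apply: eq_bigr => l /negPf -> //.
    rewrite mulNr; congr (- _); rewrite !mulr_sumr; apply: eq_bigr => l lj.
    rewrite [X in _ = _ * X](bigD1 j)//= eqxx (bigD1 l)//= (negPf lj) eqxx big1 => [|i].
      by rewrite mulr1 mulrCA.
    by case/andP => /negPf -> /negPf ->.
  rewrite fin_meanD fin_meanZ fin_mean_sum.
  rewrite (fin_mean_prod mu (fun l w => if l == j then (w == k.+1 :> nat)%:R else (w <= k)%N%:R)).
  rewrite (bigD1 j)//= eqxx muk mulrBr; congr (_ + _).
    rewrite (eq_bigr (fun=> 1 - t k.+1)) => [|l /negPf ->]; last exact: muF.
    by rewrite prodr_const cardn.
  rewrite (eq_bigr (fun=> (t k.+1 - t k.+2) * level_moment t k)) => [|l lj].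
    by rewrite sumr_const cardn -[_ *+ n.-1]mulr_natl; ring.
  rewrite (fin_mean_prod mu (fun i w => if i == j then (w == k.+1 :> nat)%:R else
        if i == l then 4 ^+ w * (w <= k)%N%:R else 1)).
  rewrite (bigD1 j)//= eqxx muk (bigD1 l)//= (negPf lj) eqxx muM big1 ?mulr1// => i.
  by case/andP => /negPf -> /negPf ->; exact: fin_mean_cst.
rewrite (eq_big_nat _ _ (F2 := fun k => fin_mean (prod_weight 'I_n mu) (G k))); last first.
  by move=> k /andP[_ kM]; rewrite GE.
rewrite -fin_mean_sum; apply: fin_mean_le => [v|v]; first exact: prod_weight_ge0.
apply: le_trans (ler_sum _ (fun k _ => dominant_indicator_ge v j k)) _.
rewrite -mulr_suml -[leRHS]mul1r ler_wpM2r//.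
(* The j-th level equals k + 1 for at most one k; the bound keeps the indicator of [v j <= L] to
   make the induction go through. *)
have le1 L : \sum_(K <= k < L) (v j == k.+1 :> nat)%:R <= (v j <= L)%N%:R :> R.
  elim: L => [|L IH]; first by rewrite big_nil//.
  have [KL|KL] := leqP K L; last by rewrite big_geq.
  rewrite big_nat_recr//=; apply: le_trans (lerD IH (lexx _)) _.
  rewrite -natrD ler_nat; case: (v j =P L.+1 :> nat) => [->|_]; first by rewrite ltnn leqnn.
  by rewrite addn0; case: (leqP (v j) L) => // /leqW ->.
by apply: le_trans (le1 _) _; case: (_ <= _)%N; rewrite ?ler01.
Qed.

Lemma dominant_prob_sum_le1 (j : 'I_n) : n%:R * dominant_prob mu j <= 1.
Proof.
have -> : n%:R * dominant_prob mu j = \sum_l dominant_prob mu l.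
  rewrite (eq_bigr (fun=> dominant_prob mu j)) => [|l _].
    by rewrite sumr_const card_ord mulr_natl.
  exact: dominant_prob_exchangeable.
rewrite -fin_mean_sum -[leRHS](fin_mean_cst (prod_weight_sum1 mu_sum1 'I_n) 1).
apply: fin_mean_le => v; first exact: prod_weight_ge0.
exact: sum_dominant_le1.
Qed.

End dominant_prob.

(** * Moments of the bin counts *)

Definition undominated (N n M : nat) (v : {ffun 'I_n -> 'I_M.+1}) : bool :=
  ~~ [exists j, dominant N v j].

Definition bin_count (N p n M : nat) (c : {ffun 'I_p -> {ffun 'I_n -> 'I_M.+1}})
  (j : 'I_n) : nat := \sum_i dominant N (c i) j.

Definition occupancy (R : realFieldType) (N p n M : nat) (z : R)
    (c : {ffun 'I_p -> {ffun 'I_n -> 'I_M.+1}}) : R :=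
  n%:R^-1 * \sum_j z ^+ bin_count N c j.

Section occupancy.
Context (R : realType) (N p n M : nat) (mu : 'I_M.+1 -> R) (q z : R).
Hypothesis N0 : (0 < N)%N.
Hypothesis n1 : (1 < n)%N.
Hypothesis p0 : (0 < p)%N.
Hypothesis z01 : 0 <= z <= 1.
Hypothesis mu_ge0 : forall w, 0 <= mu w.
Hypothesis mu_sum1 : \sum_w mu w = 1.
Hypothesis dominant_probE : forall j : 'I_n, dominant_prob N mu j = q.
Local Notation row := {ffun 'I_n -> 'I_M.+1}.
Local Notation nu := (prod_weight 'I_n mu).
Local Notation array := {ffun 'I_p -> row}.

Let n0 : (0 < n)%N := ltnW n1.
Let nu_ge0 v : 0 <= nu v. Proof. exact: prod_weight_ge0. Qed.
Let nu_sum1 : \sum_v nu v = 1. Proof. exact: prod_weight_sum1. Qed.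

Lemma expr_bool (x : R) (b : bool) : x ^+ b = 1 - (1 - x) * b%:R.
Proof. by case: b; rewrite /= ?expr1 ?expr0; ring. Qed.

Lemma mean_pow_bin_count (j : 'I_n) :
  fin_mean (prod_weight 'I_p nu) (fun c => z ^+ bin_count N c j) =
  (1 - (1 - z) * q) ^+ p.
Proof.
transitivity (fin_mean (prod_weight 'I_p nu) (fun c : array =>
    \prod_i (1 + (- (1 - z)) * (dominant N (c i) j)%:R))).
  apply: eq_bigr => c _; congr (_ * _); rewrite /bin_count expr_sum.
  by apply: eq_bigr => i _; rewrite expr_bool mulNr.
rewrite (fin_mean_prod nu (fun _ v => 1 + (- (1 - z)) * (dominant N v j)%:R)).
rewrite prodr_const card_ord fin_meanD fin_meanZ fin_mean_cst//.
by rewrite -/(dominant_prob N mu j) dominant_probE mulNr.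
Qed.

(** In one row the columns j and l cannot both dominate, so the cross term of the two factors
    vanishes and each row contributes exactly 1 - 2 (1 - z) q. *)
Lemma mean_pow_bin_count2 (j l : 'I_n) : j != l ->
  fin_mean (prod_weight 'I_p nu)
    (fun c => z ^+ bin_count N c j * z ^+ bin_count N c l) =
  (1 - 2 * (1 - z) * q) ^+ p.
Proof.
move=> jl.
transitivity (fin_mean (prod_weight 'I_p nu) (fun c : array =>
    \prod_i ((1 + (- (1 - z)) * (dominant N (c i) j)%:R)
      + (- (1 - z)) * (dominant N (c i) l)%:R))).
  apply: eq_bigr => c _; congr (_ * _); rewrite /bin_count !expr_sum -big_split.
  apply: eq_bigr => i _ /=; rewrite !expr_bool.
  have [dj|_] := boolP (dominant N (c i) j); last by rewrite /=; ring.
  have [dl|_] := boolP (dominant N (c i) l); last by rewrite /=; ring.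
  by move/eqP: jl => []; exact: dominant_inj dj dl.
rewrite (fin_mean_prod nu (fun _ v => (1 + (- (1 - z)) * (dominant N v j)%:R)
      + (- (1 - z)) * (dominant N v l)%:R)).
rewrite prodr_const card_ord !fin_meanD !fin_meanZ fin_mean_cst//.
rewrite -/(dominant_prob N mu j) -/(dominant_prob N mu l) !dominant_probE.
by congr (_ ^+ _); ring.
Qed.

Lemma mean_occupancy :
  fin_mean (prod_weight 'I_p nu) (occupancy N z) = (1 - (1 - z) * q) ^+ p.
Proof.
rewrite /occupancy fin_meanZ fin_mean_sum.
rewrite (eq_bigr (fun=> (1 - (1 - z) * q) ^+ p)) => [|j _]; last exact: mean_pow_bin_count.
by rewrite sumr_const card_ord -[X in _ * X]mulr_natl mulKf// pnatr_eq0 -lt0n.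
Qed.

Lemma mean_sqr_occupancy :
  fin_mean (prod_weight 'I_p nu) (fun c => occupancy N z c ^+ 2) <=
  n%:R^-1 + (1 - 2 * (1 - z) * q) ^+ p.
Proof.
have nR : 0 < n%:R :> R by rewrite ltr0n.
have W0 (c : array) : 0 <= prod_weight 'I_p nu c by exact: prod_weight_ge0.
have zz m : 0 <= z ^+ m <= 1.
  by move: z01 => /andP[? ?]; rewrite exprn_ge0// exprn_ile1.
pose D := fin_mean (prod_weight 'I_p nu) (fun c : array =>
  n%:R^-1 ^+ 2 * \sum_(j < n) \sum_(l < n) z ^+ bin_count N c j * z ^+ bin_count N c l).
have -> : fin_mean (prod_weight 'I_p nu) (fun c => occupancy N z c ^+ 2) = D.
  apply: eq_bigr => c _; congr (_ * _); rewrite /occupancy exprMn; congr (_ * _).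
  by rewrite expr2 mulr_suml; apply: eq_bigr => j _; rewrite mulr_sumr.
rewrite /D fin_meanZ fin_mean_sum.
pose r := (1 - 2 * (1 - z) * q) ^+ p.
have step (j : 'I_n) : fin_mean (prod_weight 'I_p nu)
    (fun c => \sum_(l < n) z ^+ bin_count N c j * z ^+ bin_count N c l) <=
    1 + \sum_(l | l != j) r.
  rewrite fin_mean_sum (bigD1 j)//=; apply: lerD.
    rewrite -[leRHS](fin_mean_cst (prod_weight_sum1 nu_sum1 'I_p) 1).
    apply: fin_mean_le => // c.
    by have := zz (bin_count N c j) => /andP[? ?]; rewrite mulr_ile1.
  by apply: ler_sum => l lj; rewrite mean_pow_bin_count2// eq_sym.
have r0 (j l : 'I_n) : j != l -> 0 <= r.
  move=> jl; rewrite /r -(mean_pow_bin_count2 jl); apply: fin_mean_ge0 => // c.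
  by rewrite mulr_ge0//; have /andP[] := zz (bin_count N c j);
    have /andP[] := zz (bin_count N c l).
have step2 (j : 'I_n) : 1 + \sum_(l | l != j) r <= 1 + n.-1%:R * r.
  by rewrite sumr_const (cardC1 j) card_ord mulr_natl.
apply: (@le_trans _ _ (n%:R^-1 ^+ 2 * \sum_(j < n) (1 + n.-1%:R * r))).
  rewrite ler_wpM2l ?exprn_ge0 ?invr_ge0//; apply: ler_sum => j _.
  exact: le_trans (step j) (step2 j).
rewrite sumr_const card_ord -[X in _ * X]mulr_natl expr2 -mulrA mulKf ?gt_eqF//.
rewrite mulrDr mulr1 lerD2l -/r.
(* The power r is nonnegative because it is the mean attached to two distinct columns; this is where
   n > 1 enters. *)
have jl : (Ordinal (ltnW n1)) != Ordinal n1 by [].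
rewrite mulrA ler_piMl ?(r0 _ _ jl)// mulrC ler_pdivrMr// mul1r ler_nat leq_pred//.
Qed.

Lemma mean_undominated :
  fin_mean nu (fun v => (undominated N v)%:R) = 1 - n%:R * q.
Proof.
transitivity (fin_mean nu (fun v => 1 + (-1) * \sum_j (dominant N v j)%:R)).
  apply: eq_bigr => v _; congr (_ * _); rewrite /undominated.
  have [/existsP[j vj]|nv] := boolP [exists j, dominant N v j].
    rewrite (bigD1 j)//= vj big1 => [|l lj]; first by rewrite /=; ring.
    rewrite (_ : dominant N v l = false)//; apply/negP => vl.
    by move/eqP: lj; apply; exact: dominant_inj vl vj.
  rewrite big1 => [|j _]; first by rewrite /=; ring.
  rewrite (_ : dominant N v j = false)//; apply/negP => vl.
  by move/negP: nv; apply; apply/existsP; exists j.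
rewrite fin_meanD fin_meanZ fin_mean_sum fin_mean_cst//.
rewrite (eq_bigr (fun=> q)) => [|j _]; last exact: dominant_probE.
by rewrite sumr_const card_ord mulr_natl mulN1r.
Qed.

(** Markov for the number of undominated rows and Chebyshev for the occupancy, in a single
    application to F + G. The second moment is taken about an arbitrary b, later the limit, so the
    mean needs no separate treatment. *)
Lemma deviation_weight (tau b : R) : 0 < tau ->
  \sum_(c : array | (tau * p%:R < \sum_i (undominated N (c i))%:R)
                 || (tau < `|occupancy N z c - b|)) prod_weight 'I_p nu c <=
  (1 - n%:R * q) / tau + (n%:R^-1 + (1 - 2 * (1 - z) * q) ^+ p
    - 2 * b * (1 - (1 - z) * q) ^+ p + b ^+ 2) / tau ^+ 2.
Proof.
move=> tau0; have pR : 0 < p%:R :> R by rewrite ltr0n.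
have W0 (c : array) : 0 <= prod_weight 'I_p nu c by exact: prod_weight_ge0.
have W1 : \sum_(c : array) prod_weight 'I_p nu c = 1 by exact: prod_weight_sum1.
pose F (c : array) : R := (tau * p%:R)^-1 * (\sum_i (undominated N (c i))%:R).
pose G (c : array) : R := (tau ^+ 2)^-1 * (occupancy N z c - b) ^+ 2.
have F0 c : 0 <= F c.
  by rewrite mulr_ge0 ?invr_ge0 ?mulr_ge0 ?(ltW tau0)//; apply: sumr_ge0.
have G0 c : 0 <= G c by rewrite mulr_ge0 ?sqr_ge0// invr_ge0 sqr_ge0.
apply: (@le_trans _ _ (fin_mean (prod_weight 'I_p nu) (fun c => F c + G c))).
  apply: fin_markov => // c; first by rewrite addr_ge0.
  case/orP => h; [rewrite -[leLHS]addr0|rewrite -[leLHS]add0r]; apply: lerD => //.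
    by rewrite /F mulrC ler_pdivlMr ?mulr_gt0// mul1r ltW.
  rewrite /G mulrC ler_pdivlMr ?exprn_gt0// mul1r -[leRHS]real_normK ?num_real//.
  by rewrite lerXn2r ?nnegrE ?normr_ge0 ?(ltW tau0) ?(ltW h).
rewrite fin_meanD; apply: lerD; rewrite fin_meanZ.
  rewrite fin_mean_sum (eq_bigr (fun=> 1 - n%:R * q)) => [|i _]; last first.
    by rewrite (fin_mean_coord nu_sum1 i (fun v => (undominated N v)%:R)) mean_undominated.
  rewrite sumr_const card_ord -[X in _ * X]mulr_natl.
  by rewrite [leLHS](_ : _ = (1 - n%:R * q) / tau)//; field; rewrite !gt_eqF.
rewrite mulrC ler_wpM2r ?invr_ge0 ?sqr_ge0//.
rewrite [leLHS](_ : _ = fin_mean (prod_weight 'I_p nu) (fun c => occupancy N z c ^+ 2)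
   + (- (2 * b)) * fin_mean (prod_weight 'I_p nu) (occupancy N z) + b ^+ 2); last first.
  rewrite -fin_meanZ -[X in _ + X](fin_mean_cst W1) -!fin_meanD.
  by apply: eq_bigr => c _; congr (_ * _); ring.
by rewrite mean_occupancy lerD2r mulNr lerD2r mean_sqr_occupancy.
Qed.

End occupancy.

(** * From levels to eigenvalues *)

Lemma sum_noninc_bool (b : nat -> bool) (M m : nat) :
  (forall i, b i.+1 -> b i) -> (m < \sum_(i < M) b i)%N = b m && (m < M)%N.
Proof.
move=> bS; have bS' i j : (i <= j)%N -> b j -> b i.
  by move=> /subnK <-; elim: (j - i)%N => // k IH /bS.
elim: M => [|M IH]; first by rewrite big_ord0 ltn0 andbF.
rewrite big_ord_recr/=; have [bM|nbM] := boolP (b M).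
  have -> : (\sum_(i < M) b i = M)%N.
    rewrite -[RHS]card_ord -sum1_card; apply: eq_bigr => i _.
    by rewrite (bS' _ _ (ltnW (ltn_ord i)) bM).
  rewrite addn1 ltnS; case: leqP => mM; rewrite ?andbF// andbT.
  by rewrite (bS' _ _ mM bM).
rewrite addn0 IH ltnS [in RHS]leq_eqVlt.
by case: (eqVneq m M) => [->|_] /=; rewrite ?(negPf nbM).
Qed.

(** A level l with 0 < l < M means 2^(l-1) < |x| <= 2^l; level 0, when M > 0, means |x| <= 1, and
    level M has no upper bound. *)
Definition level (R : realType) (M : nat) (x : R) : nat :=
  (\sum_(m < M) (2 ^+ m < `|x|)%R)%N.

Lemma level_gt (R : realType) (M m : nat) (x : R) :
  (m < level M x)%N = (2 ^+ m < `|x|) && (m < M)%N.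
Proof.
rewrite (@sum_noninc_bool (fun m => 2 ^+ m < `|x|))// => i.
by apply: le_lt_trans; rewrite exprS ler_peMl ?exprn_ge0// ler1n.
Qed.

Lemma level_le (R : realType) (M : nat) (x : R) : (level M x <= M)%N.
Proof. by rewrite leqNgt level_gt ltnn andbF. Qed.

Lemma normr_le_level (R : realType) (M : nat) (x : R) :
  (level M x < M)%N -> `|x| <= 2 ^+ level M x.
Proof.
move=> xM; have := level_gt M (level M x) x; rewrite ltnn xM andbT.
by move/esym/negbT; rewrite -leNgt.
Qed.

Lemma level_lt_normr (R : realType) (M : nat) (x : R) :
  (0 < level M x)%N -> 2 ^+ (level M x).-1 < `|x|.
Proof.
move=> x0; have := level_gt M (level M x).-1 x; rewrite (prednK x0) leqnn.
by move/esym/andP => [].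
Qed.

(** The square of x_j is at least 4^(level - 1) and the other squares are at most 4^level; the
    successor in the exponent inside [dominant] pays for this gap. The other levels are below that
    of j, hence below the cap, so their upper bounds are valid. *)
Lemma dominant_square (R : realType) (N n M : nat) (x : 'I_n -> R)
    (v : {ffun 'I_n -> 'I_M.+1}) (j : 'I_n) :
  (0 < N)%N -> (1 < n)%N -> (forall i, v i = level M (x i) :> nat) ->
  dominant N v j ->
  0 < x j ^+ 2 /\ N%:R * \sum_(l | l != j) x l ^+ 2 <= x j ^+ 2.
Proof.
move=> N0 n1 vE vj.
(* Another column is needed to make the level of x_j positive: level 0 gives no lower bound on
   |x_j|. *)
have [l0 l0j] : exists l, l != j.
  apply/existsP; rewrite -[X in is_true X]negbK negb_exists; apply/negP => /forallP h.
  have : (#|'I_n| <= 1)%N.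
    by apply/card_le1_eqP => a b _ _; move: (h a) (h b); rewrite !negbK => /eqP -> /eqP ->.
  by rewrite card_ord leqNgt n1.
have vj0 : (0 < level M (x j))%N.
  by rewrite -vE; exact: leq_ltn_trans (dominant_lt N0 vj l0j).
have lt_xj := level_lt_normr vj0.
have xj : 4 ^+ (v j).-1 <= x j ^+ 2.
  rewrite vE -[leRHS]real_normK ?num_real// (_ : 4 = 2 ^+ 2); last by rewrite -natrX.
  by rewrite exprAC lerXn2r ?nnegrE ?exprn_ge0// ltW.
split; first by apply: lt_le_trans xj; rewrite exprn_gt0.
apply: le_trans xj; rewrite -(ler_pM2l (_ : 0 < 4))// -exprS prednK ?vE// -vE.
have := vj; rewrite /dominant -(ler_nat R) natrX => /(le_trans _); apply.
rewrite natrM natr_sum mulrCA ler_wpM2l// mulr_sumr; apply: ler_sum => l lj.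
have lM : (level M (x l) < M)%N.
  by rewrite -vE; apply: leq_trans (dominant_lt N0 vj lj) _; rewrite vE level_le.
rewrite natrX [leRHS]exprS ler_pM2l// vE -[leLHS]real_normK ?num_real//.
rewrite (_ : 4 = 2 ^+ 2); last by rewrite -natrX.
by rewrite exprAC lerXn2r ?nnegrE ?exprn_ge0// normr_le_level.
Qed.

Lemma sum_normalized_sqr (R : realType) (n : nat) (x : 'I_n -> R) :
  \sum_j (x j / Num.sqrt (\sum_k x k ^+ 2)) ^+ 2 <= 1.
Proof.
have s0 : 0 <= \sum_k x k ^+ 2 by apply: sumr_ge0 => k _; exact: sqr_ge0.
under eq_bigr do rewrite exprMn exprVn sqr_sqrtr//.
rewrite -mulr_suml; have [->|sN] := eqVneq (\sum_k x k ^+ 2) 0.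
  by rewrite mul0r.
by rewrite divff.
Qed.

(** An undominated row is compared with 0, at cost at most 1. In a dominated row, let r be the
    modulus of the dominant normalized entry: the error is at most 2 - 2 r, and r >= r^2 >= 1 -
    1/N. *)
Lemma normalized_row_approx (R : realType) (N n M : nat) (x : 'I_n -> R)
    (v : {ffun 'I_n -> 'I_M.+1}) :
  (0 < N)%N -> (1 < n)%N -> (forall i, v i = level M (x i) :> nat) ->
  \sum_j (x j / Num.sqrt (\sum_k x k ^+ 2)
          - Num.sg (x j) * (dominant N v j)%:R) ^+ 2 <=
  2 / N%:R + (undominated N v)%:R.
Proof.
move=> N0 n1 vE; have NR : 0 < N%:R :> R by rewrite ltr0n.
have N2 : 0 <= 2 / N%:R :> R by rewrite divr_ge0.
set s := \sum_k x k ^+ 2; have s_ge0 : 0 <= s by apply: sumr_ge0 => k _; exact: sqr_ge0.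
rewrite /undominated; have [/existsP[j vj]|nv] := boolP [exists j, dominant N v j]; last first.
  apply: le_trans (_ : 1 <= _); last by rewrite lerDr.
  apply: le_trans (sum_normalized_sqr x).
  apply: ler_sum => j _; rewrite (_ : dominant N v j = false) ?mulr0 ?subr0//.
  by apply/negP => vl; move/negP: nv; apply; apply/existsP; exists j.
rewrite addr0; have [xj0 xjN] := dominant_square N0 n1 vE vj.
have xj_neq0 : x j != 0 by rewrite -sqrf_eq0 gt_eqF.
have sE : s = x j ^+ 2 + \sum_(l | l != j) x l ^+ 2 by rewrite /s (bigD1 j).
have sP : 0 < s.
  by rewrite sE ltr_pwDl//; apply: sumr_ge0 => k _; exact: sqr_ge0.
set y := fun i => x i / Num.sqrt s.
have -> : \sum_i (y i - Num.sg (x i) * (dominant N v i)%:R) ^+ 2 =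
    \sum_i y i ^+ 2 + 1 - 2 * (`|x j| / Num.sqrt s).
  rewrite (bigD1 j)//= vj mulr1 [in RHS](bigD1 j)//=.
  rewrite (eq_bigr (fun i => y i ^+ 2)) => [|i ij]; last first.
    rewrite (_ : dominant N v i = false) ?mulr0 ?subr0//; apply/negP => vi.
    by move/eqP: ij; apply; exact: dominant_inj vi vj.
  rewrite sqrrB sqr_sg xj_neq0 /y normrEsg /=; ring.
set r := `|x j| / Num.sqrt s.
have r0 : 0 <= r by rewrite divr_ge0// sqrtr_ge0.
have r2 : r ^+ 2 = x j ^+ 2 / s by rewrite exprMn exprVn sqr_sqrtr// real_normK ?num_real.
have r1 : r <= 1.
  rewrite -(@expr_le1 _ 2)// r2 ler_pdivrMr// mul1r sE lerDl.
  by apply: sumr_ge0 => k _; exact: sqr_ge0.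
have rN : 1 - N%:R^-1 <= r ^+ 2.
  rewrite r2 ler_pdivlMr// mulrBl mul1r lerBlDr -lerBlDl.
  rewrite mulrC ler_pdivlMr// mulrC; apply: le_trans (_ : x j ^+ 2 <= _).
    by rewrite {1}sE addrAC subrr add0r.
  by rewrite sE lerDl; apply: sumr_ge0 => k _; exact: sqr_ge0.
have := sum_normalized_sqr x; rewrite -/s -/y => y1.
have rr : r ^+ 2 <= r by rewrite expr2 ler_piMr.
lra.
Qed.

(** A row of Z has at most one nonzero entry, so distinct columns are orthogonal; the signs square
    to 1 and the diagonal counts balls. *)
Lemma dominant_gram (R : realType) (N p n M : nat) (e : 'M[R]_(p, n))
    (c : {ffun 'I_p -> {ffun 'I_n -> 'I_M.+1}}) (Z := \matrix_(i, j)
      (e i j * (dominant N (c i) j)%:R) : 'M[R]_(p, n)) :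
  (0 < N)%N -> (forall i j, dominant N (c i) j -> e i j ^+ 2 = 1) ->
  Z^T *m Z = diag_mx (\row_j (bin_count N c j)%:R).
Proof.
move=> N0 e1; apply/matrixP => j l; rewrite !mxE /bin_count.
have [->|jl] := eqVneq j l.
  rewrite mulr1n natr_sum; apply: eq_bigr => i _; rewrite !mxE -expr2.
  have [d|_] := boolP (dominant N (c i) l); last by rewrite mulr0 expr0n.
  by rewrite mulr1 e1.
rewrite mulr0n big1// => i _; rewrite !mxE.
have [dj|_] := boolP (dominant N (c i) j); last by rewrite mulr0 mul0r.
have [dl|_] := boolP (dominant N (c i) l); last by rewrite !mulr0.
by move/eqP: jl => []; exact: dominant_inj dj dl.
Qed.

(** For d = |x - y| <= 1 and x^2 <= y^2, the increment is at most exp(- x^2) (y^2 - x^2). Here y^2 -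
    x^2 <= 2 d (1 + x^2), and exp(- x^2) absorbs the factor 1 + x^2. *)
Lemma expR_sqr_lipschitz (R : realType) (x y : R) :
  `|expR (- x ^+ 2) - expR (- y ^+ 2)| <= 2 * `|x - y|.
Proof.
wlog xy : x y / x ^+ 2 <= y ^+ 2.
  move=> H; have [|/ltW] := leP (x ^+ 2) (y ^+ 2); first exact: H.
  by move=> /H; rewrite distrC (distrC y).
rewrite ger0_norm; last by rewrite subr_ge0 ler_expR lerN2.
set d : R := `|x - y|; have d0 : 0 <= d := normr_ge0 _.
have E0 := expR_gt0 (- x ^+ 2); have F0 := expR_gt0 (- y ^+ 2).
have [d1|/ltW d1] := leP 1 d.
  have : expR (- x ^+ 2) <= 1 by rewrite -expR0 ler_expR oppr_le0 sqr_ge0.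
  lra.
have E1 : expR (- x ^+ 2) * (1 + x ^+ 2) <= 1.
  by rewrite expRN mulrC ler_pdivrMr ?expR_gt0// mul1r expR_ge1Dx.
have F1 : expR (- y ^+ 2) = expR (- x ^+ 2) * expR (- (y ^+ 2 - x ^+ 2)).
  by rewrite -expRD; congr expR; ring.
have F2 := expR_ge1Dx (- (y ^+ 2 - x ^+ 2)).
have yx : y ^+ 2 - x ^+ 2 <= d * (2 * `|x| + 1).
  have -> : y ^+ 2 - x ^+ 2 = (y - x) * (2 * x) + (y - x) ^+ 2 by ring.
  have h1 : (y - x) * (2 * x) <= d * (2 * `|x|).
    apply: le_trans (ler_norm _) _.
    by rewrite !normrM distrC (ger0_norm (ler0n _ 2)).
  have h2 : (y - x) ^+ 2 <= d.
    rewrite -[leLHS]real_normK ?num_real// distrC -/d expr2 ler_piMr//.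
  lra.
have x2 : 2 * `|x| + 1 <= 2 * (1 + x ^+ 2).
  have -> : x ^+ 2 = `|x| ^+ 2 by rewrite real_normK ?num_real.
  have : 0 <= (`|x| - 1) ^+ 2 by exact: sqr_ge0.
  have : 0 <= `|x| ^+ 2 by exact: sqr_ge0.
  rewrite sqrrB; lra.
rewrite F1; set a := expR (- x ^+ 2) in E0 E1 F1 *.
set u := y ^+ 2 - x ^+ 2 in F1 F2 yx *; set b := expR (- u) in F1 F2 *.
have h3 : a - a * b <= a * u.
  have -> : a - a * b = a * (1 - b) by ring.
  by rewrite ler_pM2l//; lra.
apply: (le_trans h3).
have h4 : a * u <= a * (d * (2 * (1 + x ^+ 2))).
  rewrite ler_pM2l//; apply: le_trans yx _; exact: ler_wpM2l.
apply: (le_trans h4).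
have -> : a * (d * (2 * (1 + x ^+ 2))) = 2 * d * (a * (1 + x ^+ 2)) by ring.
by rewrite ler_piMr// mulr_ge0.
Qed.

Lemma exprn_lipschitz (R : realType) (k : nat) (a b : R) :
  0 <= a <= 1 -> 0 <= b <= 1 -> `|a ^+ k - b ^+ k| <= k%:R * `|a - b|.
Proof.
wlog ab : a b / b <= a.
  move=> H; have [|/ltW] := leP b a; first exact: H.
  by move=> /H h a1 b1; rewrite distrC (distrC a) h.
move=> /andP[a0 a1] /andP[b0 b1].
rewrite !ger0_norm ?subr_ge0 ?lerXn2r ?nnegrE//.
apply: le_trans (exprB_le _ b0 ab) _.
by rewrite ler_piMr ?mulr_ge0 ?subr_ge0// exprn_ile1.
Qed.

(** The test function takes the value 1 at 0, so the correction for null eigenvalues is p - n, and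
    its value at a bin count m is z^m. *)
Lemma correlation_exp_approx (R : realType) (N p n M k : nat)
    (x : 'I_p -> 'I_n -> R) (c : {ffun 'I_p -> {ffun 'I_n -> 'I_M.+1}})
    (theta : R) (z := expR (- 1) ^+ k)
    (Y := \matrix_(i < p, j < n) (x i j / Num.sqrt (\sum_k x i k ^+ 2))) :
  (0 < N)%N -> (1 < n)%N -> 0 < theta ->
  (forall i j, c i j = level M (x i j) :> nat) ->
  `|\sum_(y <- eigenvalues (Y *m Y^T)) expR (- y) ^+ k
    - (\sum_j z ^+ bin_count N c j + (p%:R - n%:R))| <=
  k%:R * 2 * (theta * (p%:R + n%:R) +
    (2 / N%:R * p%:R + \sum_i (undominated N (c i))%:R) / theta).
Proof.
move=> N0 n1 t0 cE.
pose e : 'M[R]_(p, n) := \matrix_(i, j) Num.sg (x i j).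
have e1 i j : dominant N (c i) j -> e i j ^+ 2 = 1.
  move=> /(dominant_square N0 n1 (cE i))[xij _].
  by rewrite mxE sqr_sg -sqrf_eq0 gt_eqF.
have := gram_perturbation Y (h := fun y => expR (- y) ^+ k) (L := k%:R * 2)
  (theta := theta) (dominant_gram N0 e1).
have h0 : expR (- 0) ^+ k = 1 :> R by rewrite oppr0 expR0 expr1n.
rewrite h0 mul1r => H.
have hN m : expR (- (m%:R : R)) ^+ k = z ^+ m.
  by rewrite /z exprAC -[expR (- 1) ^+ m]expRM_natl mulrN1.
under [X in `|_ - (X + _)|]eq_bigr do rewrite -hN.
have E01 (a : R) : 0 <= expR (- a ^+ 2) <= 1.
  by rewrite expR_ge0/= -expR0 ler_expR oppr_le0 sqr_ge0.
apply: le_trans (H _ _ _ _) _ => //.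
  move=> a b; apply: le_trans (exprn_lipschitz _ (E01 a) (E01 b)) _.
  by rewrite -mulrA ler_wpM2l// expR_sqr_lipschitz.
rewrite ler_wpM2l ?mulr_ge0// lerD2l ler_wpM2r ?invr_ge0 ?(ltW t0)//.
have -> : 2 / N%:R * p%:R = \sum_(i < p) 2 / N%:R :> R.
  by rewrite sumr_const card_ord mulr_natr.
rewrite -big_split; apply: ler_sum => i _ /=.
apply: le_trans (normalized_row_approx N0 n1 (cE i)).
by apply: ler_sum => j _; rewrite !mxE.
Qed.

(** * Law of the levels *)

(** The probability that a level is at least k, before capping: index 0 is the sure event, whence
    the shift by one in the thresholds 2^k. *)
Definition tail_seq (R : realType) (L : R -> R) (k : nat) : R :=
  if k is k'.+1 then L (2 ^+ k') else 1.

Section tail.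
Context (R : realType) (d : measure_display) (T : measurableType d)
  (Q : probability T R) (xi : {RV Q >-> R}) (L : R -> R).
Hypothesis L_gt0 : forall x, 0 < x -> 0 < L x.
Hypothesis L_tail : forall x, 0 < x -> Q [set w | x < `|xi w|] = (L x)%:E.
Hypothesis L_slow :
  forall c, 0 < c -> L (c * x) / L x @[x --> +oo] --> (1 : R).

Let p2 (k : nat) : 0 < (2 : R) ^+ k. Proof. exact: exprn_gt0. Qed.

Lemma measurable_tail (x : R) : measurable [set w | x < `|xi w|].
Proof.
have mf : measurable_fun setT (fun w => `|xi w|) by exact: measurableT_comp.
have := mf measurableT _ (measurable_itv `]x, +oo[).
rewrite setTI; congr measurable.
by apply/seteqP; split=> w; rewrite /preimage/= in_itv/= andbT.
Qed.

Lemma tail_seq_gt0 k : 0 < tail_seq L k.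
Proof. by case: k => [|k] /=; [exact: ltr01|exact: L_gt0]. Qed.

Lemma tail_seq_le1 k : tail_seq L k <= 1.
Proof.
case: k => [|k] /=; first exact: lexx.
by rewrite -lee_fin -L_tail// probability_le1//; exact: measurable_tail.
Qed.

Lemma tail_seq_noninc k : tail_seq L k.+1 <= tail_seq L k.
Proof.
case: k => [|k]; first exact: tail_seq_le1.
rewrite -lee_fin /= -!L_tail//; apply: le_measure; rewrite ?inE; try exact: measurable_tail.
move=> w /=; apply: le_lt_trans.
by rewrite exprS ler_peMl ?exprn_ge0// ler1n.
Qed.

Lemma tail_seq_cvg0 (e : R) : 0 < e -> exists k, tail_seq L k <= e.
Proof.
move=> e0; pose F k := [set w | 2 ^+ k < `|xi w|].
have F0 : \bigcap_k F k = set0.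
  rewrite -subset0 => w wF.
  have [n nP] := exists_natr_gt `|xi w|.
  have := wF n I; rewrite /F/= => h; have := lt_trans h nP.
  by rewrite -natrX ltr_nat ltnNge ltnW// ltn_expl.
have /fine_cvgP[_] : Q (F n) @[n --> \oo] --> 0%:E.
  rewrite -[X in _ --> X](measure0 Q) -F0; apply: nonincreasing_cvg_mu.
  - by rewrite ltey_eq fin_num_measure//; exact: measurable_tail.
  - by move=> k; exact: measurable_tail.
  - by rewrite F0; exact: measurable0.
  - apply/nonincreasing_seqP => k; apply/subsetPset => w /=.
    by apply: le_lt_trans; rewrite exprS ler_peMl ?exprn_ge0// ler1n.
move=> /cvgrPdist_le/(_ _ e0)[k _ /(_ k (leqnn k))]/=.
rewrite sub0r normrN => kP; exists k.+1 => /=.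
by apply: le_trans kP; rewrite /F L_tail//= ler_norm.
Qed.

Lemma tail_seq_ratio (e : R) : 0 < e -> exists k0, forall k, (k0 <= k)%N ->
  tail_seq L k <= (1 + e) * tail_seq L k.+1.
Proof.
move=> e0; have e1 : 0 < 1 + e by rewrite addr_gt0.
(* This tolerance turns closeness of L(2x) / L(x) to 1 into L(2x) / L(x) >= 1 / (1 + e). *)
have /cvgrPdist_le/(_ (1 - (1 + e)^-1)) := L_slow (ltr0n R 2).
rewrite subr_gt0 invf_lt1// ltrDl => /(_ e0)[A [Ar AP]].
have [n nP] := exists_natr_gt A.
exists n.+1 => -[//|k] nk /=; rewrite ltnS in nk.
have := AP (2 ^+ k); rewrite /= -exprS => H.
have {}H : 1 - L (2 ^+ k.+1) / L (2 ^+ k) <= 1 - (1 + e)^-1.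
  apply: le_trans (ler_norm _) _; apply: H.
  apply: (lt_trans nP); rewrite -natrX ltr_nat.
  exact: leq_ltn_trans nk (ltn_expl _ _).
move: H; rewrite lerD2l lerN2 ler_pdivlMr ?L_gt0// mulrC ler_pdivrMr//.
by rewrite mulrC.
Qed.

End tail.

Section level_law.
Context (R : realType) (d : measure_display) (T : measurableType d)
  (Q : probability T R) (xi : {RV Q >-> R}) (L : R -> R) (M : nat).
Hypothesis L_tail : forall x, 0 < x -> Q [set w | x < `|xi w|] = (L x)%:E.

Lemma level_geE (k : nat) : [set w | (k <= level M (xi w))%N] =
  if k is k'.+1 then if (k' < M)%N then [set w | 2 ^+ k' < `|xi w|] else set0
  else setT.
Proof.
case: k => [|k]; first by apply/seteqP; split.
case: ifP => kM; apply/seteqP; split=> w //=; rewrite level_gt kM ?andbT//.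
by rewrite andbF.
Qed.

Lemma measurable_level_ge (k : nat) : measurable [set w | (k <= level M (xi w))%N].
Proof.
rewrite level_geE; case: k => // k; case: ifP => // _; exact: measurable_tail.
Qed.

Lemma level_law (i : 'I_M.+1) :
  Q [set w | level M (xi w) = i] = (level_pmf (tail_seq L) i)%:E.
Proof.
have geP k : Q [set w | (k <= level M (xi w))%N] =
    (if (k <= M)%N then tail_seq L k else 0)%:E.
  rewrite level_geE; case: k => [|k] /=; first exact: probability_setT.
  by case: ifP => kM; rewrite ?measure0// L_tail// exprn_gt0.
have mi : measurable [set w | level M (xi w) = i].
  rewrite (_ : [set w | _] = [set w | (i <= level M (xi w))%N] `\`
      [set w | (i.+1 <= level M (xi w))%N]).
    by apply: measurableD; exact: measurable_level_ge.
  apply/seteqP; split=> w /=; first by move=> ->; rewrite leqnn ltnn.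
  by move=> [h1 /negP]; rewrite -leqNgt => h2; apply/eqP; rewrite eqn_leq h1 h2.
have := geP i.
rewrite (_ : [set w | (i <= _)%N] = [set w | level M (xi w) = i] `|`
      [set w | (i.+1 <= level M (xi w))%N]); last first.
  apply/seteqP; split=> w /=.
    by rewrite leq_eqVlt => /orP[/eqP ->|]; [left|right].
  by case=> [->//|/ltnW].
rewrite measureU//; last 2 first.
- exact: measurable_level_ge.
- by rewrite -subset0 => w /= [->]; rewrite ltnn.
have iM : (i <= M)%N by rewrite -ltnS.
rewrite [X in (_ + X)%E = _ -> _](geP i.+1) iM /level_pmf EFinB => <-.
rewrite ltn_neqAle iM andbT; case: eqP => _ /=; first by rewrite adde0 sube0.
by rewrite addeK.
Qed.

End level_law.

Lemma finite_event_le (R : realType) (d : measure_display)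
    (T : measurableType d) (P : probability T R) (V : eqType) (c : T -> V)
    (r : seq V) : (forall v, measurable [set w | c w = v]) ->
  measurable [set w | c w \in r] /\
  (P [set w | c w \in r] <= \sum_(v <- r) P [set w | c w = v])%E.
Proof.
move=> mc; elim: r => [|v r [mr Pr]].
  have -> : [set w | c w \in [::]] = set0 by apply/seteqP; split.
  by rewrite measure0 big_nil.
rewrite (_ : [set w | c w \in v :: r] = [set w | c w = v] `|` [set w | c w \in r]).
  split; first exact: measurableU.
  rewrite big_cons; apply: le_trans (measureU2 _ _ _) _ => //.
  by rewrite leeD2l.
apply/seteqP; split=> w /=; rewrite inE.
  by case/orP => [/eqP|]; [left|right].
by case=> [->|->]; rewrite ?eqxx ?orbT.
Qed.

Section array_law.
Context (R : realType) (d : measure_display) (T : measurableType d)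
  (P : probability T R) (d' : measure_display) (T' : measurableType d')
  (Q : probability T' R) (xi : {RV Q >-> R}) (X : nat -> nat -> {RV P >-> R}).
Context (L : R -> R) (M p n : nat).
Hypothesis L_tail : forall x, 0 < x -> Q [set w | x < `|xi w|] = (L x)%:E.
Hypothesis X_iid : iid_copies (fun ij : nat * nat => X ij.1 ij.2) xi.

Definition level_array (w : T) : {ffun 'I_p -> {ffun 'I_n -> 'I_M.+1}} :=
  [ffun i : 'I_p => [ffun j : 'I_n => inord (level M (X i j w))]].

Lemma level_arrayE (w : T) (i : 'I_p) (j : 'I_n) : level_array w i j = level M (X i j w) :> nat.
Proof. by rewrite !ffunE inordK// ltnS level_le. Qed.

Lemma measurable_level_set (k : nat) : measurable [set x : R | level M x = k].
Proof.
have mge l : measurable [set x : R | (l <= level M x)%N].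
  case: l => [|l]; first by rewrite (_ : [set _ | _] = setT)//; apply/seteqP; split.
  rewrite (_ : [set x | _] = [set x : R | (2 ^+ l < `|x|) && (l < M)%N]); last first.
    by apply/seteqP; split=> x /=; rewrite level_gt.
  case: (l < M)%N; last first.
    by rewrite (_ : [set _ | _] = set0)//; apply/seteqP; split=> x //=; rewrite andbF.
  rewrite (_ : [set x | _] = [set x : R | 2 ^+ l < `|x|]); last first.
    by apply/seteqP; split=> x /=; rewrite andbT.
  have mf : measurable_fun setT (fun x : R => `|x|) by exact: normr_measurable.
  have := mf measurableT _ (measurable_itv `]2 ^+ l, +oo[).
  rewrite setTI; congr measurable.
  by apply/seteqP; split=> x; rewrite /preimage/= in_itv/= andbT.
rewrite (_ : [set x | _] = [set x : R | (k <= level M x)%N] `\`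
    [set x | (k.+1 <= level M x)%N]); first exact: measurableD.
apply/seteqP; split=> w /=; first by move=> ->; rewrite leqnn ltnn.
by move=> [h1 /negP]; rewrite -leqNgt => h2; apply/eqP; rewrite eqn_leq h1 h2.
Qed.

Lemma array_law (v : {ffun 'I_p -> {ffun 'I_n -> 'I_M.+1}}) :
  P [set w | level_array w = v] =
  (prod_weight 'I_p (prod_weight 'I_n (@level_pmf R (tail_seq L) M)) v)%:E.
Proof.
pose key (ij : 'I_p * 'I_n) : nat * nat := (ij.1 : nat, ij.2 : nat).
have key_inj : injective key.
  by move=> [i j] [k l] [/val_inj -> /val_inj ->].
pose s := [seq key ij | ij <- index_enum ('I_p * 'I_n)%type].
have us : uniq s by rewrite map_inj_uniq// index_enum_uniq.
pose J : {fset nat * nat} := [fset x in s]%fset.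
(* Independence is stated for finite sets of pairs of naturals, so the target levels are extended by
   0 outside the array. *)
pose f (x : nat * nat) : nat :=
  if insub x.1 is Some i then if insub x.2 is Some j then v i j : nat else 0%N else 0%N.
have fE ij : f (key ij) = v ij.1 ij.2 by rewrite /f /= !valK.
have [Xind Xlaw] := X_iid.
have -> : [set w | level_array w = v] =
    \bigcap_(x in [set` J]) (X x.1 x.2 @^-1` [set y | level M y = f x]).
  apply/seteqP; split=> w /=.
    move=> wv x /=; rewrite !inE => /mapP[ij _ ->].
    by rewrite /preimage/= fE -wv level_arrayE.
  move=> wJ; apply/ffunP => i; apply/ffunP => j; apply/val_inj => /=.
  rewrite level_arrayE; have := wJ (key (i, j)); rewrite /preimage/= fE; apply.
  by rewrite !inE; apply/mapP; exists (i, j); rewrite ?mem_index_enum.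
have := Xind J (fun x => [set y | level M y = f x])
  (fun x => measurable_level_set _) => ->.
have Jperm : perm_eq J s.
  by rewrite uniq_perm ?fset_uniq// => x; rewrite !inE.
rewrite (perm_big _ Jperm)/= /s big_map /prod_weight pair_bigA/=.
rewrite -prodEFin; apply: eq_bigr => -[i j] _ /=.
have := Xlaw (key (i, j)) _ (measurable_level_set (f (key (i, j)))) => /= ->.
by rewrite fE -(level_law L_tail).
Qed.

Lemma measurable_array_set (v : {ffun 'I_p -> {ffun 'I_n -> 'I_M.+1}}) :
  measurable [set w | level_array w = v].
Proof.
rewrite (_ : [set w | _] = \bigcap_(i in [set: 'I_p]) \bigcap_(j in [set: 'I_n])
   (X i j @^-1` [set y | level M y = v i j])).
  apply: fin_bigcap_measurable => // i _; apply: fin_bigcap_measurable => // j _.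
  rewrite -[X in measurable X]setTI; apply: measurable_funP => //.
  exact: measurable_level_set.
apply/seteqP; split=> w /=.
  by move=> <- i _ j _; rewrite /preimage/= level_arrayE.
move=> H; apply/ffunP => i; apply/ffunP => j; apply/val_inj => /=.
by rewrite level_arrayE; exact: H.
Qed.

Lemma array_event_le (A : pred {ffun 'I_p -> {ffun 'I_n -> 'I_M.+1}}) :
  measurable [set w | A (level_array w)] /\
  (P [set w | A (level_array w)] <=
   (\sum_(v | A v) prod_weight 'I_p (prod_weight 'I_n (@level_pmf R (tail_seq L) M)) v)%:E)%E.
Proof.
pose r := enum A.
have -> : [set w | A (level_array w)] = [set w | level_array w \in r].
  by apply/seteqP; split=> w /=; rewrite mem_enum.
have [mA PA] := finite_event_le P r measurable_array_set.
split=> //; apply: (le_trans PA).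
rewrite big_enum/= -sumEFin.
by apply: lee_sum => v _; rewrite array_law.
Qed.

End array_law.

(** * Limits as n tends to infinity *)

Lemma cvg_natrV (R : realType) : (n%:R : R)^-1 @[n --> \oo] --> (0 : R).
Proof. by rewrite -(cvg_shiftS _); exact: cvg_harmonic. Qed.

(** Squeeze from exp(- x / (1 - x)) <= 1 - x <= exp(- x), raised to the power p. *)
Lemma expr1B_cvg (R : realType) (x : nat -> R) (p : nat -> nat) (g : R) :
  (forall n, 0 <= x n) -> x n @[n --> \oo] --> 0 ->
  (p n)%:R * x n @[n --> \oo] --> g ->
  (1 - x n) ^+ p n @[n --> \oo] --> expR (- g).
Proof.
move=> x0 xc pxc.
have up : expR (- ((p n)%:R * x n)) @[n --> \oo] --> expR (- g).
  apply: (@cvg_comp _ _ _ (fun n => - ((p n)%:R * x n)) expR); last exact: continuous_expR.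
  exact: cvgN.
have lo : expR (- ((p n)%:R * x n / (1 - x n))) @[n --> \oo] --> expR (- g).
  apply: (@cvg_comp _ _ _ (fun n => - ((p n)%:R * x n / (1 - x n))) expR);
    last exact: continuous_expR.
  apply: cvgN; rewrite -[g in X in _ --> X]divr1; apply: cvgM => //.
  apply: cvgV; first exact: oner_neq0.
  rewrite -[X in _ --> X]subr0; apply: cvgB => //; exact: cvg_cst.
apply: squeeze_cvgr lo up.
have : \forall n \near \oo, x n < 1.
  have /cvgrPdist_lt/(_ 1 ltr01) := xc.
  apply: filterS => n; rewrite sub0r normrN; exact: le_lt_trans (ler_norm _).
apply: filterS => n x1; have y0 : 0 < 1 - x n by rewrite subr_gt0.
rewrite (_ : - (_ / _) = (p n)%:R * - (x n / (1 - x n))) ?mulrN ?mulrA//.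
rewrite -!mulrA -[- (_ * (_ * _))]mulrN -[- (_ * x n)]mulrN !expRM_natl.
apply/andP; split.
  rewrite lerXn2r ?nnegrE ?expR_ge0 ?(ltW y0)// expRN -[leRHS]invrK.
  rewrite lef_pV2 ?posrE ?expR_gt0 ?invr_gt0//.
  apply: le_trans (expR_ge1Dx _).
  by rewrite [leLHS](_ : _ = 1 + x n / (1 - x n))//; field; rewrite gt_eqF.
rewrite lerXn2r ?nnegrE ?expR_ge0 ?(ltW y0)//.
exact: expR_ge1Dx.
Qed.

Section deviation_limit.
Context (R : realType) (t : nat -> R).
Hypothesis t0 : t 0%N = 1.
Hypothesis t_gt0 : forall k, 0 < t k.
Hypothesis t_le1 : forall k, t k <= 1.
Hypothesis t_noninc : forall k, t k.+1 <= t k.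
Hypothesis t_cvg0 : forall e : R, 0 < e -> exists k, t k <= e.
Hypothesis t_ratio : forall e : R, 0 < e ->
  exists k0, forall k, (k0 <= k)%N -> t k <= (1 + e) * t k.+1.

Lemma dominant_prob_cvg (N : nat) : (0 < N)%N ->
  exists (M : nat -> nat) (q : nat -> R),
  [/\ forall n (j : 'I_n), dominant_prob N (@level_pmf R t (M n)) j = q n,
      forall n, 0 <= q n, q n @[n --> \oo] --> 0 &
      n%:R * q n @[n --> \oo] --> (1 : R)].
Proof.
move=> N0.
have /choice[M MP] : forall n, exists M, n%:R ^+ 2 * t M <= 1.
  case=> [|n]; first by exists 0%N; rewrite expr0n mul0r ler01.
  have n2 : 0 < (n.+1%:R : R) ^+ 2 by rewrite exprn_gt0.
  have [M MP] : exists M, t M <= ((n.+1%:R : R) ^+ 2)^-1.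
    by apply: t_cvg0; rewrite invr_gt0.
  by exists M; rewrite mulrC -ler_pdivlMr// mul1r.
(* Column 0 represents all columns by exchangeability; n = 0 has no column and gets the value 0. *)
pose q n : R := if n is n'.+1 then
  dominant_prob N (@level_pmf R t (M n'.+1)) (ord0 : 'I_n'.+1) else 0.
have t_ge0 k : 0 <= t k by exact: ltW.
have pmf_ge0 m w : 0 <= @level_pmf R t m w by exact: level_pmf_ge0.
have q0 n : 0 <= q n.
  case: n => [|n] /=; first exact: lexx.
  by apply: fin_mean_ge0 => // v; exact: prod_weight_ge0.
have nq1 n : n%:R * q n <= 1.
  case: n => [|n]; first by rewrite mul0r ler01.
  exact: dominant_prob_sum_le1.
have nqc : n%:R * q n @[n --> \oo] --> (1 : R).
  apply/cvgrPdist_le => e e0.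
  have [n0 n0P] := dominant_lower_bound t_gt0 t_le1 t_noninc t_cvg0 t_ratio N e0.
  exists (maxn 1 n0) => // n /=; rewrite geq_max => /andP[n1 n0n].
  rewrite ger0_norm ?subr_ge0//.
  have [K KP] := n0P n (M n) n0n (MP n).
  rewrite lerBlDr -lerBlDl; apply: (le_trans KP).
  case: n n1 {n0n KP} => // n _; rewrite ler_pM2l//.
  exact: dominant_prob_ge.
exists M, q; split => //.
- by case=> [[]//|n] j; exact: dominant_prob_exchangeable.
- apply: (@squeeze_cvgr _ _ _ _ (fun=> 0) (fun n => n%:R^-1)).
  + exists 1%N => // n /= n0; rewrite q0/= -[leRHS]mul1r ler_pdivlMr ?ltr0n// mulrC.
    exact: nq1.
  + exact: cvg_cst.
  + exact: cvg_natrV.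
Qed.

Lemma deviation_weight_small (N : nat) (p : nat -> nat) (gamma z tau delta : R) :
  (0 < N)%N -> p n @[n --> \oo] --> \oo ->
  (p n)%:R / n%:R @[n --> \oo] --> gamma -> 0 <= z <= 1 -> 0 < tau -> 0 < delta ->
  \forall n \near \oo, exists M : nat,
  \sum_(c : {ffun 'I_(p n) -> {ffun 'I_n -> 'I_M.+1}}
      | (tau * (p n)%:R < \sum_i (undominated N (c i))%:R)
     || (tau < `|occupancy N z c - expR (- (gamma * (1 - z)))|))
    prod_weight 'I_(p n) (prod_weight 'I_n (@level_pmf R t M)) c <= delta.
Proof.
move=> N0 pc pnc z01 tau0 delta0.
have [M [q [qE q0 qc nqc]]] := dominant_prob_cvg N0.
have t_ge0 k : 0 <= t k by exact: ltW.
have [z0 z1] := andP z01.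
have pqc : (p n)%:R * q n @[n --> \oo] --> gamma.
  rewrite -[X in _ --> X]mulr1.
  apply: cvg_trans (cvgM pnc nqc); apply: near_eq_cvg.
  exists 1%N => // n /= n0.
  by rewrite mulrA divfK// pnatr_eq0 -lt0n.
have powc (s : R) : 0 <= s ->
    (1 - s * q n) ^+ p n @[n --> \oo] --> expR (- (s * gamma)).
  move=> s0; apply: expr1B_cvg => [n| |].
  - by rewrite mulr_ge0.
  - by rewrite -[X in _ --> X](mulr0 s); apply: cvgM => //; exact: cvg_cst.
  - under eq_fun do rewrite mulrCA.
    by apply: cvgM => //; exact: cvg_cst.
set b := expR (- (gamma * (1 - z))).
have z1' : 0 <= 1 - z by rewrite subr_ge0.
(* The second moment tends to b^2 and the mean to b, so the quadratic expression tends to b^2 - 2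
   b^2 + b^2 = 0. *)
have bc : (1 - n%:R * q n) / tau + (n%:R^-1 + (1 - 2 * (1 - z) * q n) ^+ p n
    - 2 * b * (1 - (1 - z) * q n) ^+ p n + b ^+ 2) / tau ^+ 2 @[n --> \oo] --> (0 : R).
  have -> : (0 : R) = (1 - 1) / tau + (0 + b ^+ 2 - 2 * b * b + b ^+ 2) / tau ^+ 2.
    by rewrite subrr mul0r; ring.
  apply: cvgD.
    by apply: cvgM; [apply: cvgB => //; exact: cvg_cst|exact: cvg_cst].
  apply: cvgM; last exact: cvg_cst.
  apply: cvgD; last exact: cvg_cst.
  apply: cvgB.
    apply: cvgD; first exact: cvg_natrV.
    have -> : b ^+ 2 = expR (- (2 * (1 - z) * gamma)).
      by rewrite /b -expRM_natl; congr expR; ring.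
    by apply: powc; rewrite mulr_ge0.
  apply: cvgM; first exact: cvg_cst.
  by rewrite /b (mulrC gamma); exact: powc.
have /cvgrPdist_le/(_ _ delta0) bd := bc.
have pp : \forall n \near \oo, (0 < p n)%N by move/cvgnyPgt : pc; exact.
have n2 : \forall n \near \oo, (1 < n)%N by exists 2%N.
apply: filterS3 bd pp n2 => n H p0 n1; exists (M n).
apply: le_trans (deviation_weight N0 n1 p0 z01 _ _ (qE n) b tau0) _.
- by move=> w; exact: level_pmf_ge0.
- exact: sum_level_pmf.
- by move: H; rewrite sub0r normrN; apply: le_trans; exact: ler_norm.
Qed.

End deviation_limit.

(** Laplace transform of the zero-inflated Poisson law at the integer k, that is, its generating
    function at exp(- k). *)
Definition zip_laplace (R : realType) (gamma : R) (k : nat) : R :=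
  1 - gamma^-1 + gamma^-1 * expR (- (gamma * (1 - expR (- 1) ^+ k))).

Section exp_statistic.
Context (R : realType) (d : measure_display) (T : measurableType d)
  (P : probability T R) (d' : measure_display) (T' : measurableType d')
  (Q : probability T' R) (xi : {RV Q >-> R}) (X : nat -> nat -> {RV P >-> R})
  (p : nat -> nat) (gamma : R) (L : R -> R).
Hypothesis gamma0 : 0 < gamma.
Hypothesis p_cvg : p n @[n --> \oo] --> \oo.
Hypothesis pn_cvg : (p n)%:R / n%:R @[n --> \oo] --> gamma.
Hypothesis X_iid : iid_copies (fun ij : nat * nat => X ij.1 ij.2) xi.
Hypothesis L_gt0 : forall x, 0 < x -> 0 < L x.
Hypothesis L_tail : forall x, 0 < x -> Q [set w | x < `|xi w|] = (L x)%:E.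
Hypothesis L_slow :
  forall c, 0 < c -> L (c * x) / L x @[x --> +oo] --> (1 : R).

Definition exp_statistic (k n : nat) (w : T) : R :=
  (p n)%:R^-1 * \sum_(y <- eigenvalues (sample_correlation X (p n) n w)) expR (- y) ^+ k.

(** The exceptional set is an event on the levels, hence measurable by construction, and such sets
    can be united over finitely many k. *)
Lemma exp_statistic_cvg (k : nat) (rho delta : R) : 0 < rho -> 0 < delta ->
  \forall n \near \oo, exists B : set T, [/\ measurable B, (P B <= delta%:E)%E &
    forall w, ~ B w -> `|exp_statistic k n w - zip_laplace gamma k| <= rho].
Proof.
move=> rho0 delta0; pose z : R := expR (- 1) ^+ k.
have z01 : 0 <= z <= 1.
  have e1 : expR (- 1) <= 1 :> R by rewrite -[leRHS]expR0 ler_expR lerN10.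
  by rewrite /z exprn_ge0 ?expR_ge0//= exprn_ile1// expR_ge0.
pose b := expR (- (gamma * (1 - z))).
have b0 : 0 <= b by exact: expR_ge0.
have b1 : b <= 1.
  rewrite /b -[leRHS]expR0 ler_expR oppr_le0 mulr_ge0 ?(ltW gamma0)// subr_ge0.
  by case/andP: z01.
pose G : R := 2 / gamma; have G0 : 0 < G by rewrite divr_gt0.
(* Two quarters of rho go to the spectral comparison, one to the occupancy and one to n / p. [theta]
   makes K theta (1 + G) = r, [kappa] makes K kappa / theta = r, and G eventually bounds n / p. *)
pose r : R := rho / 4; have r0 : 0 < r by rewrite divr_gt0.
pose K : R := k%:R * 2 + 1.
have K0 : 0 < K by rewrite ltr_wpDl// mulr_ge0.
pose theta : R := r / (K * (1 + G)).
have G1 : 0 < 1 + G by rewrite addr_gt0.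
have theta0 : 0 < theta by rewrite divr_gt0// mulr_gt0.
pose kappa : R := r * theta / K.
have kappa0 : 0 < kappa by rewrite divr_gt0// mulr_gt0.
pose tau : R := Num.min (kappa / 2) (r / G).
have tau0 : 0 < tau by rewrite /tau lt_min; apply/andP; split; exact: divr_gt0.
have tau1 : tau <= kappa / 2 by rewrite /tau ge_min lexx.
have tau2 : G * tau <= r by rewrite mulrC -ler_pdivlMr// /tau ge_min lexx orbT.
have [N NP] := exists_natr_gt (4 / kappa).
have NR : 0 < N%:R :> R by apply: lt_trans NP; rewrite divr_gt0.
have N0 : (0 < N)%N by rewrite -(ltr_nat R).
have N2 : 2 / N%:R <= kappa / 2.
  rewrite ler_pdivrMr//; move: NP; rewrite ltr_pdivrMr// => NP; lra.
have np_cvg : n%:R / (p n)%:R @[n --> \oo] --> gamma^-1.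
  under eq_fun do rewrite -invf_div.
  by apply: cvgV => //; rewrite gt_eqF.
have near1 : \forall n \near \oo, n%:R / (p n)%:R <= G.
  have /cvgrPdist_le/(_ gamma^-1) := np_cvg; rewrite invr_gt0 => /(_ gamma0).
  apply: filterS => n; rewrite distrC => /(le_trans (ler_norm _)).
  by rewrite /G; lra.
have near2 : \forall n \near \oo, `|n%:R / (p n)%:R - gamma^-1| <= r.
  have /cvgrPdist_le/(_ r r0) := np_cvg.
  by apply: filterS => n; rewrite distrC.
have near3 : \forall n \near \oo, (0 < p n)%N by move/cvgnyPgt : p_cvg; exact.
have near4 : \forall n \near \oo, (1 < n)%N by exists 2%N.
have dev := deviation_weight_small (t := tail_seq L) (erefl _) (tail_seq_gt0 L_gt0)
  (tail_seq_le1 L_tail) (tail_seq_noninc L_tail) (tail_seq_cvg0 L_tail)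
  (tail_seq_ratio L_gt0 L_slow) N0 p_cvg pn_cvg z01 tau0 delta0.
near=> n.
have n1 : (1 < n)%N by near: n.
have p0 : (0 < p n)%N by near: n.
have npG : n%:R / (p n)%:R <= G by near: n.
have npr : `|n%:R / (p n)%:R - gamma^-1| <= r by near: n.
have [M MP] : exists M : nat,
  \sum_(c : {ffun 'I_(p n) -> {ffun 'I_n -> 'I_M.+1}}
      | (tau * (p n)%:R < \sum_i (undominated N (c i))%:R)
     || (tau < `|occupancy N z c - expR (- (gamma * (1 - z)))|))
    prod_weight 'I_(p n) (prod_weight 'I_n (@level_pmf R (tail_seq L) M)) c <= delta.
  by near: n.
have pR : 0 < (p n)%:R :> R by rewrite ltr0n.
pose A (c : {ffun 'I_(p n) -> {ffun 'I_n -> 'I_M.+1}}) :=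
  (tau * (p n)%:R < \sum_i (undominated N (c i))%:R)
     || (tau < `|occupancy N z c - b|).
have [mA PA] := array_event_le L_tail X_iid A.
exists [set w | A (level_array X M (p n) n w)]; split => //.
  by apply: (le_trans PA); rewrite lee_fin.
move=> w /negP; set c := level_array X M (p n) n w.
rewrite negb_or -!leNgt => /andP[und occ].
have cE (i : 'I_(p n)) (j : 'I_n) : c i j = level M (X i j w) :> nat.
  exact: level_arrayE.
have := @correlation_exp_approx R N (p n) n M k (fun i j => X i j w) c theta N0 n1 theta0 cE.
rewrite -/z -/(normalized_data X (p n) n w) -/(sample_correlation X (p n) n w).
rewrite /exp_statistic; set S : R := \sum_(y <- eigenvalues _) _.
set Z : R := \sum_j z ^+ _; set U : R := \sum_i (undominated _ _)%:R in und *.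
move=> H; have U0 : 0 <= U by exact: sumr_ge0.
have N20 : 0 <= 2 / N%:R :> R by rewrite divr_ge0.
have ZE : Z = n%:R * occupancy N z c.
  by rewrite /occupancy mulVKf// pnatr_eq0 -lt0n ltnW.
pose x := n%:R / (p n)%:R : R; rewrite -/x in npG npr.
have x0 : 0 <= x by rewrite divr_ge0.
have xE : n%:R = x * (p n)%:R by rewrite divfK// gt_eqF.
have step1 : `|S - (Z + ((p n)%:R - n%:R))| <= 2 * r * (p n)%:R.
  apply: (le_trans H).
  apply: le_trans (_ : K * (theta * ((1 + G) * (p n)%:R) + kappa * (p n)%:R / theta) <= _).
    apply: ler_pM => //.
    - apply: addr_ge0; first by rewrite mulr_ge0 ?addr_ge0// ltW.
      by rewrite divr_ge0 ?(ltW theta0)// addr_ge0// mulr_ge0.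
    - by rewrite /K lerDl.
    - apply: lerD.
        rewrite ler_pM2l// xE -[X in X + _]mul1r -mulrDl ler_pM2r// lerD2l//.
      rewrite ler_pM2r ?invr_gt0//.
      have h1 : 2 / N%:R * (p n)%:R <= kappa / 2 * (p n)%:R by rewrite ler_pM2r.
      have h2 : tau * (p n)%:R <= kappa / 2 * (p n)%:R by rewrite ler_pM2r.
      by lra.
  rewrite le_eqVlt; apply/orP; left; apply/eqP; rewrite /kappa /theta; field.
  by rewrite !gt_eqF.
have step2 : (p n)%:R^-1 * S - zip_laplace gamma k =
    (p n)%:R^-1 * (S - (Z + ((p n)%:R - n%:R)))
    + (x * (occupancy N z c - b) + (x - gamma^-1) * (b - 1)).
  rewrite ZE xE /zip_laplace -/z -/b; field.
  by rewrite !gt_eqF.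
rewrite step2.
have h1 : `|(p n)%:R^-1 * (S - (Z + ((p n)%:R - n%:R)))| <= 2 * r.
  rewrite normrM gtr0_norm ?invr_gt0// mulrC ler_pdivrMr//.
have h2 : `|x * (occupancy N z c - b)| <= r.
  rewrite normrM ger0_norm//; apply: le_trans tau2.
  by apply: ler_pM.
have h3 : `|(x - gamma^-1) * (b - 1)| <= r.
  rewrite normrM; apply: le_trans npr; rewrite ler_piMr//.
  by rewrite ler0_norm ?subr_le0// opprB lerBlDr lerDl.
apply: le_trans (ler_normD _ _) _.
have h4 := ler_normD (x * (occupancy N z c - b)) ((x - gamma^-1) * (b - 1)).
have rE : rho = 4 * r by rewrite /r; field.
rewrite rE; lra.
Unshelve. all: by end_near.
Qed.

End exp_statistic.

(** * Integrals and measurability *)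

Lemma bounded_fun_ex (R : realType) (f : R -> R) :
  bounded_fun f -> exists2 B, 0 <= B & forall x, `|f x| <= B.
Proof.
move=> [M [_ /(_ (Num.max 0 M + 1))]] H.
exists (Num.max 0 M + 1) => [|x].
  by rewrite addr_ge0// le_max lexx.
by apply: H => //; rewrite ltr_pwDr// le_max lexx orbT.
Qed.

Lemma RintegralE (R : realType) (d : measure_display) (T : measurableType d)
    (mu : {measure set T -> \bar R}) (f : T -> R) :
  \int[mu]_x f x =
  fine (\int[mu]_x (f^\+ x)%R%:E - \int[mu]_x (f^\- x)%R%:E)%E.
Proof.
rewrite /Rintegral integralE; congr (fine (_ - _)%E).
  by apply: eq_integral => x _; rewrite funerpos.
by apply: eq_integral => x _; rewrite funerneg.
Qed.

Section esd_integral.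
Context (R : realType) (p : nat) (A : 'M[R]_p).

Lemma ge0_integral_esd (f : R -> R) : measurable_fun setT f ->
  (forall x, 0 <= f x) ->
  (\int[esd A]_x (f x)%:E)%E =
  (p%:R^-1 * \sum_(y <- eigenvalues A) f y)%:E.
Proof.
move=> mf f0; have mEf : measurable_fun setT (EFin \o f) by exact/measurable_EFinP.
rewrite /esd ge0_integral_mscale//; last by move=> x _; rewrite lee_fin.
rewrite ge0_integral_measure_sum//; last by move=> x _; rewrite lee_fin.
rewrite EFinM; congr (_ * _)%E.
rewrite (big_nth 0) big_mkord -sumEFin; apply: eq_bigr => i _.
by rewrite integral_dirac// diracT mul1e.
Qed.

Lemma Rintegral_esd (f : R -> R) : measurable_fun setT f ->
  \int[esd A]_x f x = p%:R^-1 * \sum_(y <- eigenvalues A) f y.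
Proof.
move=> mf.
have mp : measurable_fun setT (f ^\+)%R by exact: measurable_funrpos.
have mn : measurable_fun setT (f ^\-)%R by exact: measurable_funrneg.
rewrite RintegralE.
rewrite !ge0_integral_esd// -EFinB/= -mulrBr -sumrB; congr (_ * _).
by apply: eq_bigr => y _; rewrite -[in RHS](funrposBneg f).
Qed.

End esd_integral.

Section zip_integral.
Context (R : realType) (gamma : {posnum R}).
Local Notation nu := (zip_measure gamma).

Lemma ge0_integral_zip (f : R -> R) : measurable_fun setT f ->
  (forall x, 0 <= f x) ->
  (\int[nu]_x (f x)%:E)%E =
  (\sum_(0 <= k <oo) (zip_pmf gamma%:num k * f k%:R)%:E)%E.
Proof.
move=> mf f0; have mEf : measurable_fun setT (EFin \o f) by exact/measurable_EFinP.
rewrite /zip_measure ge0_integral_measure_series//; last by move=> x _; rewrite lee_fin.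
apply: eq_eseriesr => k _.
rewrite ge0_integral_mscale//; last by move=> x _; rewrite lee_fin.
by rewrite integral_dirac// diracT mul1e.
Qed.

(** The measure is carried by the naturals, so x may be replaced by |x|; this keeps exp(- |x|) in
    [0, 1] on the whole line. *)
Lemma eq_Rintegral_zip (f g : R -> R) : measurable_fun setT f ->
  measurable_fun setT g -> (forall k : nat, f k%:R = g k%:R) ->
  \int[nu]_x f x = \int[nu]_x g x.
Proof.
move=> mf mg fg.
have mp (h : R -> R) : measurable_fun setT h -> measurable_fun setT (h ^\+)%R.
  by move=> ?; exact: measurable_funrpos.
have mn (h : R -> R) : measurable_fun setT h -> measurable_fun setT (h ^\-)%R.
  by move=> ?; exact: measurable_funrneg.
rewrite !RintegralE !ge0_integral_zip//; try exact: mp; try exact: mn.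
by congr (fine (_ - _)); apply: eq_eseriesr => k _; rewrite /funrpos /funrneg fg.
Qed.

Lemma zip_integrable (f : R -> R) (B : R) : measurable_fun setT f ->
  (forall x, `|f x| <= B) -> nu.-integrable setT (EFin \o f).
Proof.
move=> mf fB; apply: measurable_bounded_integrable => //.
  by rewrite zip_measureT ltry.
by exists B; split; rewrite ?num_real// => M BM x _; apply: le_trans (fB x) _; exact: ltW.
Qed.

Lemma zip_mean_le : (\int[nu]_x (1 + `|x|)%:E <= 2%:E)%E.
Proof.
have m1 : measurable_fun setT (fun x : R => 1 + `|x|).
  by apply: measurable_funD => //; exact: measurableT_comp.
rewrite ge0_integral_zip//.
have g0 : 0 < gamma%:num by [].
have t0 k : 0 <= zip_pmf gamma%:num k * (1 + `|k%:R|).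
  by rewrite mulr_ge0 ?zip_pmf_ge0// addr_ge0.
apply: lime_le.
  by apply: is_cvg_nneseries => k _ _; rewrite lee_fin.
apply: nearW => -[|n]; first by rewrite big_geq// lee_fin.
rewrite sumEFin lee_fin.
under eq_bigr do rewrite mulrDr mulr1 normr_nat.
rewrite big_split/= [leRHS](_ : _ = 1 + 1)//; apply: lerD.
  rewrite -lee_fin -(zip_measureT gamma) zip_measureE -sumEFin.
  under eq_eseriesr do rewrite diracT mule1.
  by apply: nneseries_lim_ge => k _ _; rewrite lee_fin zip_pmf_ge0.
rewrite big_nat_recl//= mulr0 add0r.
(* The factor k cancels in k!, leaving a partial sum of the exponential series: the mean is at most
   1. *)
have -> : \sum_(0 <= i < n) zip_pmf gamma%:num i.+1 * i.+1%:R =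
    expR (- gamma%:num) * series (exp_coeff gamma%:num) n.
  rewrite /series/= mulr_sumr; apply: eq_bigr => i _.
  rewrite /zip_pmf/= /exp_coeff/= factS natrM exprS.
  by field; rewrite nat1r !pnatr_eq0 -lt0n fact_gt0/= (gt_eqF g0).
rewrite expRN -ler_pdivlMl ?invr_gt0 ?expR_gt0// invrK mulr1.
apply: nondecreasing_cvgn_le; last exact: is_cvg_series_exp_coeff.
apply/nondecreasing_seqP => m; rewrite /series/= big_nat_recr//= lerDl.
by rewrite /exp_coeff/= divr_ge0// exprn_ge0.
Qed.

Lemma Rintegral_zip_exp (k : nat) :
  \int[nu]_x (expR (- `|x|) ^+ k) = zip_laplace gamma%:num k.
Proof.
have g0 : 0 < gamma%:num by [].
pose z : R := expR (- 1) ^+ k.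
have m1 : measurable_fun setT (fun x : R => expR (- `|x|) ^+ k).
  by apply: measurable_funX; apply: measurableT_comp => //; apply: measurableT_comp => //.
rewrite /Rintegral ge0_integral_zip//.
have zE j : expR (- `|j%:R|) ^+ k = z ^+ j :> R.
  by rewrite normr_nat /z exprAC -[expR (- 1) ^+ j]expRM_natl mulrN1.
under eq_eseriesr do rewrite zE.
have -> : zip_laplace gamma%:num k = fine (zip_laplace gamma%:num k)%:E by [].
congr fine; apply/cvg_lim => //; rewrite -(cvg_shiftS _).
under eq_fun do rewrite sumEFin.
apply/fine_cvgP; split; first exact: nearW.
set e := expR (- gamma%:num).
have E n : \sum_(0 <= k < n.+1) zip_pmf gamma%:num k * z ^+ k =
    1 - gamma%:num^-1 + gamma%:num^-1 * e * series (exp_coeff (gamma%:num * z)) n.+1.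
  rewrite /series/= !big_nat_recl//= /exp_coeff/= expr0 fact0 invr1 mulr1 mulrDr mulr1.
  rewrite expr0 mulr1 addrA; congr (_ + _); rewrite mulr_sumr.
  apply: eq_bigr => i _; rewrite /zip_pmf/= exprMn -/e.
  by rewrite -!mulrA; congr (_ * (_ * (_ * _))); rewrite mulrC.
rewrite (_ : _ \o _ = fun n => 1 - gamma%:num^-1 +
    gamma%:num^-1 * e * series (exp_coeff (gamma%:num * z)) n.+1); last first.
  by apply/funext => n /=; rewrite E.
rewrite [X in _ --> X](_ : _ = 1 - gamma%:num^-1 +
    gamma%:num^-1 * e * expR (gamma%:num * z)); last first.
  by rewrite /zip_laplace -mulrA /e -expRD -/z; congr (_ + _ * expR _); ring.
apply: cvgD; first exact: cvg_cst.
apply: cvgMl_tmp; rewrite (cvg_shiftS (series _)).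
exact: is_cvg_series_exp_coeff.
Qed.

Let u (x : R) : R := expR (- `|x|).

Let u01 x : 0 <= u x <= 1.
Proof. by rewrite expR_ge0/= -[leRHS]expR0 ler_expR oppr_le0. Qed.

Let measurable_u : measurable_fun setT u.
Proof. by apply: measurableT_comp => //; apply: measurableT_comp. Qed.

Let u_bound (c : R) k x : `|c * u x ^+ k| <= `|c|.
Proof.
have /andP[? ?] := u01 x.
by rewrite normrM ler_piMr// ger0_norm ?exprn_ge0// exprn_ile1.
Qed.

Let measurable_term (c : R) k : measurable_fun setT (fun x => c * u x ^+ k).
Proof. by apply: measurable_funM => //; exact: measurable_funX. Qed.

Lemma Rintegral_zip_poly (c : nat -> R) (m : nat) :
  [/\ measurable_fun setT (fun x : R => \sum_(k < m) c k * u x ^+ k),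
      forall x, `|\sum_(k < m) c k * u x ^+ k| <= \sum_(k < m) `|c k| &
      \int[nu]_x (\sum_(k < m) c k * u x ^+ k) =
      \sum_(k < m) c k * zip_laplace gamma%:num k].
Proof.
elim: m => [|m [mm bm IH]].
  split.
  - under eq_fun do rewrite big_ord0.
    exact: measurable_cst.
  - by move=> x; rewrite !big_ord0 normr0.
  - by under eq_Rintegral do rewrite big_ord0; rewrite big_ord0 Rintegral_cst// mul0r.
split.
- under eq_fun do rewrite big_ord_recr/=.
  exact: measurable_funD.
- by move=> x; rewrite !big_ord_recr/=; apply: le_trans (ler_normD _ _) _; exact: lerD.
under eq_Rintegral do rewrite big_ord_recr/=.
rewrite big_ord_recr/= RintegralD//.
- rewrite IH; congr (_ + _).
  have i1 : nu.-integrable setT (EFin \o (fun x => u x ^+ m)).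
    apply: (@zip_integrable _ 1); first exact: measurable_funX.
    by move=> x; have := u_bound 1 m x; rewrite mul1r normr1.
  by rewrite RintegralZl// Rintegral_zip_exp.
- exact: zip_integrable mm bm.
- exact: zip_integrable (measurable_term _ _) (u_bound _ _).
Qed.

Lemma zip_exponential_approx (f : R -> R) (B e : R) (q : {poly R}) :
  continuous f -> (forall x, `|f x| <= B) -> 0 <= e ->
  (forall x, 0 <= x -> `|f x - q.[expR (- x)]| <= e * (1 + x)) ->
  `|\int[nu]_x f x - \sum_(k < size q) q`_k * zip_laplace gamma%:num k| <= e * 2.
Proof.
move=> cf fB e0 fq.
have mf : measurable_fun setT f by exact: continuous_measurable_fun.
have mfn : measurable_fun setT (fun x : R => f `|x|) by exact: measurableT_comp.
rewrite (@eq_Rintegral_zip f (fun x : R => f `|x|))//; last by move=> k; rewrite normr_nat.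
have [mq bq <-] := Rintegral_zip_poly (fun k => q`_k) (size q).
have if_ : nu.-integrable setT (EFin \o (fun x : R => f `|x|)) by exact: zip_integrable mfn _.
have iq := zip_integrable mq bq.
rewrite -RintegralB//.
have md : measurable_fun setT (fun x : R => f `|x| - \sum_(k < size q) q`_k * u x ^+ k).
  exact: measurable_funB.
rewrite -lee_fin EFin_normr_Rintegral//; last first.
  apply: (@zip_integrable _ (B + \sum_(k < size q) `|q`_k|)) => // x.
  by apply: le_trans (ler_normB _ _) _; exact: lerD.
apply: le_trans (le_abse_integral _ _ _) _ => //; first exact/measurable_EFinP.
apply: le_trans (_ : \int[nu]_x (e%:E * (1 + `|(x : R)|)%:E) <= _)%E.
  apply: ge0_le_integral => //.
  - by apply: measurableT_comp => //; exact/measurable_EFinP.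
  - apply/measurable_EFinP; apply: measurable_funM => //.
    by apply: measurable_funD => //; exact: measurableT_comp.
  - by move=> x _; rewrite -EFinM abse_EFin lee_fin -horner_coef; exact: fq.
rewrite ge0_integralZl//.
- by rewrite EFinM lee_wpmul2l//; exact: zip_mean_le.
- apply/measurable_EFinP; apply: measurable_funD => //; exact: measurableT_comp.
Qed.

End zip_integral.

Section correlation_eigenvalues.
Context (R : realType) (T : Type) (X : nat -> nat -> T -> R) (p n : nat) (w : T).
Local Notation A := (sample_correlation X p n w).

Lemma sample_correlation_sym : A^T = A.
Proof. by rewrite /sample_correlation trmx_mul trmxK. Qed.

(** The trace is the sum of the squared norms of the normalized rows. The spectral distribution thus
    has mean at most 1, as the weight 1 + x requires. *)
Lemma sum_eigenvalues_correlation : \sum_(y <- eigenvalues A) y <= p%:R.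
Proof.
have := mxtrace_exp_eigenvalues 1 sample_correlation_sym; rewrite expr1.
under eq_bigr do rewrite expr1.
move=> <-; rewrite -[p in leRHS]card_ord -sum1_card natr_sum.
apply: ler_sum => i _; rewrite mxE.
apply: le_trans (sum_normalized_sqr (fun j : 'I_n => X i j w)).
by apply: ler_sum => j _; rewrite !mxE -expr2.
Qed.

Lemma eigenvalues_correlation_ge0 y : y \in eigenvalues A -> 0 <= y.
Proof. exact: eigenvalues_gram_ge0. Qed.

Lemma eigenvalues_correlation_le y : y \in eigenvalues A -> y <= p%:R.
Proof.
move=> yA; apply: le_trans sum_eigenvalues_correlation.
rewrite (big_rem y)//= lerDl big_seq; apply: sumr_ge0 => x /mem_rem.
exact: eigenvalues_correlation_ge0.
Qed.

End correlation_eigenvalues.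

(** * Measurability of spectral sums *)

Section spectral_measurability.
Context (R : realType) (d : measure_display) (T : measurableType d) (m : nat).
Context (A : T -> 'M[R]_m) (b : R).
Hypothesis b0 : 0 < b.
Hypothesis A_sym : forall w, (A w)^T = A w.
Hypothesis mA : forall i j, measurable_fun setT (fun w => A w i j).
Hypothesis Ab : forall w y, y \in eigenvalues (A w) -> 0 <= y <= b.

Lemma measurable_mxtrace_exp k : measurable_fun setT (fun w => \tr (A w ^+ k)).
Proof.
have mk i j : measurable_fun setT (fun w => (A w ^+ k) i j).
  elim: k i j => [|k IH] i j.
    by under eq_fun do rewrite expr0; exact: measurable_cst.
  have E w : (A w ^+ k.+1) i j = \sum_l A w i l * (A w ^+ k) l j.
    by rewrite exprS mxE.
  under eq_fun do rewrite E.
  by apply: measurable_sum => l; exact: measurable_funM.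
by apply: measurable_sum => i; exact: mk.
Qed.

Lemma measurable_sum_eigenvalues_poly (q : {poly R}) :
  measurable_fun setT (fun w => \sum_(y <- eigenvalues (A w)) q.[y]).
Proof.
have E w : \sum_(y <- eigenvalues (A w)) q.[y] =
    \sum_(k < size q) q`_k * \tr (A w ^+ k).
  under eq_bigr do rewrite horner_coef.
  rewrite exchange_big; apply: eq_bigr => k _.
  by rewrite mxtrace_exp_eigenvalues// mulr_sumr.
under eq_fun do rewrite E.
apply: measurable_sum => k; apply: measurable_funM; first exact: measurable_cst.
exact: measurable_mxtrace_exp.
Qed.

(** Polynomial spectral sums are combinations of traces of powers, hence measurable; Weierstrass on
    [0, b] gives the general case as a pointwise limit, so no eigenvalue has to be measurable by
    itself. *)
Lemma measurable_sum_eigenvalues (f : R -> R) (B : R) :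
  continuous f -> (forall x, `|f x| <= B) ->
  measurable_fun setT (fun w => \sum_(y <- eigenvalues (A w)) f y).
Proof.
move=> cf fB.
have cfb : continuous (fun u => f (b * u)).
  move=> u; apply: (@continuous_comp _ _ _ (fun u => b * u) f); last exact: cf.
  by apply: cvgM; [exact: cvg_cst|exact: cvg_id].
have /choice[q qP] : forall k : nat, exists q : {poly R}, forall u, 0 <= u <= 1 ->
    `|f (b * u) - q.[u]| <= k.+1%:R^-1.
  by move=> k; apply: (weierstrass_approximation cfb (fun u => fB _)); rewrite invr_gt0.
pose h k w := \sum_(y <- eigenvalues (A w)) (q k \Po (b^-1 *: 'X)).[y].
apply: (@measurable_fun_cvg _ _ _ setT h) => [k|w _].
  exact: measurable_sum_eigenvalues_poly.
apply/cvgrPdist_le => e e0.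
have [k0 k0P] := exists_natr_gt (m%:R / e).
exists k0 => // k /= kk; rewrite /h -sumrB.
apply: le_trans (ler_norm_sum _ _ _) _.
apply: (@le_trans _ _ (\sum_(y <- eigenvalues (A w)) k.+1%:R^-1)).
  rewrite big_seq [leRHS]big_seq; apply: ler_sum => y /Ab /andP[y0 yb].
  rewrite horner_comp !hornerE -{1}(mulVKf (lt0r_neq0 b0) y); apply: qP.
  by rewrite mulr_ge0 ?invr_ge0 ?(ltW b0)//= mulrC ler_pdivrMr// mul1r.
rewrite big_const_seq count_predT iter_addr_0 size_eigenvalues// -[leLHS]mulr_natl.
rewrite ler_pdivrMr// -ler_pdivrMl// mulrC; apply/ltW/(lt_trans k0P).
by rewrite ltr_nat ltnS.
Qed.

End spectral_measurability.

Lemma measurable_sample_correlation (R : realType) (d : measure_display)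
    (T : measurableType d) (P : probability T R) (X : nat -> nat -> {RV P >-> R})
    (p n : nat) (i j : 'I_p) :
  measurable_fun setT (fun w => sample_correlation X p n w i j).
Proof.
have mY (k : 'I_p) (l : 'I_n) : measurable_fun setT (fun w => normalized_data X p n w k l).
  (* The inverse square root becomes a measurable real power; both sides vanish when the row norm is
     0. *)
  have E w : normalized_data X p n w k l =
      X k l w * (\sum_(r < n) X k r w ^+ 2) `^ (- 2^-1).
    rewrite mxE powRN powR12_sqrt//.
    by apply: sumr_ge0 => r _; exact: sqr_ge0.
  under eq_fun do rewrite E.
  apply: measurable_funM; first exact: measurable_funP.
  apply: (@measurableT_comp _ _ _ _ _ _ (fun s => s `^ (- 2^-1))); first exact: measurable_powR.
  by apply: measurable_sum => r; apply: measurable_funX; exact: measurable_funP.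
have E w : sample_correlation X p n w i j =
    \sum_l normalized_data X p n w i l * normalized_data X p n w j l.
  by rewrite mxE; apply: eq_bigr => l _; rewrite [X in _ * X]mxE.
under eq_fun do rewrite E.
by apply: measurable_sum => l; exact: measurable_funM.
Qed.

Theorem theorem4p9 (R : realType)
    (d : measure_display) (T : measurableType d) (P : probability T R)
    (d' : measure_display) (T' : measurableType d') (Q : probability T' R)
    (xi : {RV Q >-> R}) (X : nat -> nat -> {RV P >-> R})
    (p : nat -> nat) (gamma : R) (gamma_gt0 : 0 < gamma) :
  p n @[n --> \oo] --> \oo ->
  (p n)%:R / n%:R @[n --> \oo] --> gamma ->
  iid_copies (fun ij : nat * nat => X ij.1 ij.2) xi ->
  symmetric_rv xi ->
  slowly_varying_rv xi ->
  cvg_weakly_in_probability P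
    (fun n w => esd (sample_correlation X (p n) n w))
    (zip_measure (PosNum gamma_gt0)).
Proof.
move=> pc pnc iid _ [L [L0 Lt Ls]] f cf /bounded_fun_ex[B B0 fB] eps eps0.
have mf : measurable_fun setT f by exact: continuous_measurable_fun.
set nu := zip_measure _.
(* The budget is 2 e for each polynomial approximation and e for the statistics, 5 e in all. *)
pose e := eps / 8; have e0 : 0 < e by rewrite divr_gt0.
have [q qP] := exponential_approximation cf fB e0.
pose C := \sum_(k < size q) `|q`_k| + 1.
have C0 : 0 < C by rewrite ltr_wpDl// sumr_ge0.
pose rho := e / C; have rho0 : 0 < rho by rewrite divr_gt0.
have nuP := zip_exponential_approx (PosNum gamma_gt0) cf fB (ltW e0) qP.
have p0 : \forall n \near \oo, (0 < p n)%N by move/cvgnyPgt : pc; exact.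
have mE n : (0 < p n)%N -> measurable
    [set w | eps < `|\int[esd (sample_correlation X (p n) n w)]_x f x - \int[nu]_x f x|].
  move=> pn0; have pR : 0 < (p n)%:R :> R by rewrite ltr0n.
  have m1 : measurable_fun setT
      (fun w => `|\int[esd (sample_correlation X (p n) n w)]_x f x - \int[nu]_x f x|).
    apply: measurableT_comp => //; apply: measurable_funB => //.
    under eq_fun do rewrite Rintegral_esd//.
    apply: measurable_funM => //.
    apply: (measurable_sum_eigenvalues pR _ _ _ cf fB).
    - by move=> w; exact: sample_correlation_sym.
    - by move=> i j; exact: measurable_sample_correlation.
    - move=> w y yA; rewrite (eigenvalues_correlation_ge0 yA).
      exact: eigenvalues_correlation_le yA.
  have := m1 measurableT _ (measurable_itv `]eps, +oo[).
  rewrite setTI; congr measurable.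
  by apply/seteqP; split=> w; rewrite /preimage/= in_itv/= andbT.
apply/fine_cvgP; split.
  apply: filterS p0 => n pn0; rewrite fin_num_measure//; exact: mE.
apply/cvgrPdist_le => delta delta0.
pose m := size q.
(* The successor keeps the division meaningful when q is the zero polynomial. *)
pose del := delta / m.+1%:R.
have del0 : 0 < del by rewrite divr_gt0.
(* Induction on l intersects the finitely many eventual statements, so that a single rank serves
   every exponent below m. *)
have key l : \forall n \near \oo, forall k, (k < l)%N ->
    exists B : set T, [/\ measurable B, (P B <= del%:E)%E &
    forall w, ~ B w -> `|exp_statistic X p k n w - zip_laplace gamma k| <= rho].
  elim: l => [|l IH]; first by apply: nearW.
  have := exp_statistic_cvg gamma_gt0 pc pnc iid L0 Lt Ls l rho0 del0.
  apply: filterS2 IH => n IH Hm k; rewrite ltnS leq_eqVlt => /orP[/eqP ->//|].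
  exact: IH.
apply: filterS2 (key m) p0 => n {}key pn0.
have pR : 0 < (p n)%:R :> R by rewrite ltr0n.
have /choice[Bs BsP] : forall k, exists Bk : set T, (k < m)%N ->
    [/\ measurable Bk, (P Bk <= del%:E)%E &
    forall w, ~ Bk w -> `|exp_statistic X p k n w - zip_laplace gamma k| <= rho].
  move=> k; have [km|_] := ltnP k m; last by exists set0.
  by have [Bk ?] := key k km; exists Bk.
rewrite sub0r normrN /=; set E := [set w | _ < _].
have mEn : measurable E by exact: mE.
pose U := \big[setU/set0]_(k < m) Bs k.
have mU : measurable U by apply: bigsetU_measurable => k _; have [] := BsP k (ltn_ord k).
(* Outside the exceptional sets every exponential statistic is within rho of its limit, hence so is,
   within e, their combination [V] with the coefficients of q. *)
have EU : E `<=` U.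
  move=> w /= Ew; apply: contrapT => Uw.
  have stat (k : 'I_m) : `|exp_statistic X p k n w - zip_laplace gamma k| <= rho.
    have [_ _] := BsP k (ltn_ord k); apply => Bw; apply: Uw.
    by rewrite /U -bigcup_mkord; exists (k : nat) => //=; exact: ltn_ord.
  move: Ew; apply/negP; rewrite -leNgt Rintegral_esd//.
  set s := eigenvalues _.
  pose V := \sum_(k < m) q`_k * exp_statistic X p k n w.
  have VE : V = (p n)%:R^-1 * \sum_(y <- s) q.[expR (- y)].
    rewrite /V; under [in RHS]eq_bigr do rewrite horner_coef.
    rewrite exchange_big mulr_sumr; apply: eq_bigr => k _.
    by rewrite /exp_statistic mulrCA mulr_sumr.
  have h1 : `|(p n)%:R^-1 * \sum_(y <- s) f y - V| <= e * 2.
    rewrite VE -mulrBr -sumrB normrM gtr0_norm ?invr_gt0// mulrC ler_pdivrMr//.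
    apply: le_trans (ler_norm_sum _ _ _) _.
    apply: (@le_trans _ _ (\sum_(y <- s) e * (1 + y))).
      rewrite big_seq [leRHS]big_seq; apply: ler_sum => y ys; apply: qP.
      exact: eigenvalues_correlation_ge0 ys.
    rewrite -mulr_sumr -[leRHS]mulrA ler_pM2l// big_split/= mulrDl mul1r.
    apply: lerD; last exact: sum_eigenvalues_correlation.
    rewrite big_const_seq count_predT iter_addr_0 size_eigenvalues//.
    exact: sample_correlation_sym.
  have h2 : `|V - \sum_(k < m) q`_k * zip_laplace gamma k| <= e.
    rewrite /V -sumrB; apply: le_trans (ler_norm_sum _ _ _) _.
    apply: (@le_trans _ _ (\sum_(k < m) `|q`_k| * rho)).
      by apply: ler_sum => k _; rewrite -mulrBr normrM ler_wpM2l.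
    rewrite -mulr_suml /rho mulrCA ler_piMr ?(ltW e0)// ler_pdivrMr// mul1r.
    by rewrite /C lerDl.
  set I1 := _ * _; set I2 := Rintegral _ _ _.
  have -> : I1 - I2 = (I1 - V) + (V - \sum_(k < m) q`_k * zip_laplace gamma k)
     - (I2 - \sum_(k < m) q`_k * zip_laplace gamma k) by ring.
  apply: le_trans (ler_normB _ _) _.
  apply: le_trans (lerD (ler_normD _ _) nuP) _.
  apply: le_trans (lerD (lerD h1 h2) (lexx _)) _.
  by rewrite /e; lra.
rewrite ger0_norm ?fine_ge0//.
rewrite -lee_fin fineK ?fin_num_measure//.
apply: le_trans (le_measure _ _ _ EU) _; rewrite ?inE//.
have PU : (P U <= \sum_(k < m) P (Bs k))%E.
  by apply: Boole_inequality => k km; have [] := BsP k km.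
apply: le_trans PU _.
apply: (@le_trans _ _ (\sum_(k < m) del%:E)%E).
  by apply: lee_sum => k _; have [] := BsP k (ltn_ord k).
rewrite sumEFin lee_fin sumr_const card_ord -mulr_natl /del mulrCA ler_piMr ?(ltW delta0)//.
by rewrite ler_pdivrMr// mul1r ler_nat.
Qed.
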